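(* Let $\Gamma$ be a group acting by isometries on two Gromov hyperbolic spaces $(X,d_1)$ and $(Y,d_2)$, both actions being non-elementary. Assume that there is a $\Gamma$-equivariant continuous map from $\Lambda_X\Gamma$ to $\Lambda_Y\Gamma$, where $\Lambda_X\Gamma$ and $\Lambda_Y\Gamma$ are the limit sets of $\Gamma$ for the two actions. If $$\lim_{\ell_{d_1}([\gamma])\to\infty,\ [\gamma]\in\mathcal{C}^*}\frac{\ell_{d_1}([\gamma])}{\ell_{d_2}([\gamma])}=1,$$ then $\ell_{d_1}=\ell_{d_2}$ on $\Gamma$.
   Context: For a metric space $(X,d)$ and $o\in X$, the Gromov product is $\langle p,q\rangle_o=\frac12(d(p,o)+d(q,o)-d(p,q))$. $(X,d)$ is $\delta$-Gromov hyperbolic if $\langle p,q\rangle_o\ge\min\{\langle p,r\rangle_o,\langle r,q\rangle_o\}-\delta$ for all $o,p,q,r\in X$, and Gromov hyperbolic if this holds for some $\delta>0$. The Gromov boundary $\partial X$ is the set of equivalence classes of sequences $(x_n)$ in $X$ with $\langle x_i,x_j\rangle_o\to\infty$ as $i,j\to\infty$, where $(x_n)\sim(y_n)$ if $\langle x_i,y_j\rangle_o\to\infty$ as $i,j\to\infty$; it carries its usual topology. For a group $\Gamma$ acting by isometries on $X$, the limit set $\Lambda_X\Gamma\subset\partial X$ is $\overline{\Gamma\cdot o}\cap\partial X$ (independent of $o\in X$). A hyperbolic element is an isometry with positive translation length; it has exactly two fixed points on $\partial X$. The action is non-elementary if $\Gamma$ contains two hyperbolic elements with disjoint pairs of fixed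 points in $\partial X$. The translation length of $\gamma\in\Gamma$ is $\ell_d(\gamma)=\lim_{n\to\infty}\frac{d(\gamma^n o,o)}{n}$, which does not depend on $o$ and depends only on the conjugacy class $[\gamma]$. An element $\gamma\in\Gamma$ is primitive if $\gamma\ne\eta^n$ for every $\eta\in\Gamma$ and every integer $n$ with $|n|>1$. $\mathcal{C}^*$ denotes the set of conjugacy classes of primitive elements of $\Gamma$.
   Formalization: The formal theorem also assumes that there are primitive conjugacy classes of arbitrarily large d_1-length, so that the limit is meaningful; otherwise PSL_2(R) acting on (H^2,d) and (H^2,2d), which has no primitive elements, is a counterexample. *)

(* Defs.v *)
From HB Require Import structures.
From mathcomp Require Import all_boot all_order all_algebra.
From mathcomp Require Import all_classical all_reals all_analysis.
From mathcomp Require Import ring lra.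

Set Implicit Arguments.
Unset Strict Implicit.
Unset Printing Implicit Defensive.

Import Order.TTheory GRing.Theory Num.Theory.
Import numFieldNormedType.Exports.

Local Open Scope classical_set_scope.
Local Open Scope ring_scope.

Section GromovProduct.
Context {R : realType} {X : metricType R}.
Implicit Types (o p q r : X) (x y : nat -> X).

Definition gromov_product o p q : R :=
  (mdist p o + mdist q o - mdist p q) / 2.

Definition delta_hyperbolic (delta : R) :=
  forall o p q r : X,
    Num.min (gromov_product o p r) (gromov_product o r q) - delta
      <= gromov_product o p q.

Definition asymptotic o x y :=
  gromov_product o (x ij.1) (y ij.2) @[ij --> (\oo, \oo)] --> +oo.

Definition gromov_seq o x := asymptotic o x x.

Definition asymptotic_class o x : set (nat -> X) :=
  [set y | gromov_seq o y /\ asymptotic o x y].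

Lemma gromov_product_shift o p q p' q' (C : R) :
  mdist p' q' = mdist p q -> mdist p o - C <= mdist p' o ->
  mdist q o - C <= mdist q' o ->
  gromov_product o p q - C <= gromov_product o p' q'.
Proof. by rewrite /gromov_product => ->; lra. Qed.

Lemma asymptotic_shift o x y x' y' (C : R) :
  (forall i j, mdist (x' i) (y' j) = mdist (x i) (y j)) ->
  (forall i, mdist (x i) o - C <= mdist (x' i) o) ->
  (forall i, mdist (y i) o - C <= mdist (y' i) o) ->
  asymptotic o x y -> asymptotic o x' y'.
Proof.
move=> xy xx yy /cvgryPge H; apply/cvgryPge => A.
have := H (A + C); apply: filterS => -[i j] /= h.
have := gromov_product_shift (xy i j) (xx i) (yy j).
by lra.
Qed.

End GromovProduct.

Definition gromov_hyperbolic {R : realType} (X : metricType R) :=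
  exists2 delta : R, 0 < delta & delta_hyperbolic (X := X) delta.

(* In a Gromov hyperbolic space asymptoticity at [o] is an equivalence relation
   on [gromov_seq o] that does not depend on [o]; a boundary point is one of its
   classes, kept as the set of all sequences converging to it. *)
Record boundary {R : realType} {X : metricType R} (o : X) := Boundary {
  boundary_seqs : set (nat -> X) ;
  boundary_seqsP : exists2 x, gromov_seq o x &
                              boundary_seqs = asymptotic_class o x }.

Variant bordification {R : realType} {X : metricType R} (o : X) :=
  | Inside of X
  | AtInfinity of boundary o.

Arguments Inside {R X o}.
Arguments AtInfinity {R X o}.

Section Boundary.
Context {R : realType} {X : metricType R} (o : X).
Implicit Types (xi eta : boundary o) (z w : bordification o).

Lemma boundary_eq xi eta : boundary_seqs xi = boundary_seqs eta -> xi = eta.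
Proof.
case: xi eta => [A hA] [B hB] /= AB; rewrite AB in hA *.
by congr Boundary; exact: Prop_irrelevance.
Qed.

HB.instance Definition _ := gen_eqMixin (boundary o).
HB.instance Definition _ := gen_choiceMixin (boundary o).
HB.instance Definition _ := gen_eqMixin (bordification o).
HB.instance Definition _ := gen_choiceMixin (bordification o).

Definition seqs_to z : set (nat -> X) :=
  match z with
  | Inside p => [set cst p]
  | AtInfinity xi => boundary_seqs xi
  end.

(* The extension of the Gromov product to the bordification: the infimum of
   liminf_(i,j) <x_i, y_j>_o over all sequences representing the two points.
   Taking a supremum instead changes it by a bounded amount only, hence gives
   the same topology. *)
Definition ext_gromov_product z w : \bar R :=
  ereal_inf [set limf_einf
                   (fun ij => (gromov_product o (xy.1 ij.1) (xy.2 ij.2))%:E)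
                   (filter_prod \oo \oo)
            | xy in seqs_to z `*` seqs_to w].

Definition bord_ball xi (t : R) : set (bordification o) :=
  [set z | (t%:E < ext_gromov_product z (AtInfinity xi))%E].

(* The balls [bord_ball xi t], t : R, form a basis of (not necessarily open)
   neighbourhoods of [xi]. *)
Definition bord_open (W : set (bordification o)) :=
  open [set p : X | W (Inside p)] /\
  forall xi, W (AtInfinity xi) -> exists t : R, bord_ball xi t `<=` W.

Lemma bord_openT : bord_open setT.
Proof. by split=> [|xi _]; [exact: openT | exists 0]. Qed.

Lemma bord_openI W1 W2 : bord_open W1 -> bord_open W2 -> bord_open (W1 `&` W2).
Proof.
move=> [oW1 hW1] [oW2 hW2]; split; first exact: openI.
move=> xi [/hW1[t1 h1] /hW2[t2 h2]]; exists (Num.max t1 t2) => z hz.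
split; [apply: h1 | apply: h2]; apply: le_lt_trans hz;
  by rewrite lee_fin le_max lexx ?orbT.
Qed.

Lemma bord_open_bigU (I : Type) (W : I -> set (bordification o)) :
  (forall i, bord_open (W i)) -> bord_open (\bigcup_i W i).
Proof.
move=> hW; split.
  rewrite (_ : [set p : X | _] = \bigcup_i [set p : X | W i (Inside p)]) //.
  by apply: bigcup_open => i _; case: (hW i).
move=> xi [i _ Wi]; have [t ht] := (hW i).2 _ Wi.
by exists t => z /ht Wz; exists i.
Qed.

HB.instance Definition _ := isOpenTopological.Build (bordification o)
  bord_openT bord_openI bord_open_bigU.

HB.instance Definition _ :=
  Topological.copy (boundary o) (initial_topology (@AtInfinity R X o)).

End Boundary.

Record isometric_action {R : realType} (G : groupType) (X : metricType R) :=
  IsometricAction {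
    act :> G -> X -> X ;
    act1 : forall p, act 1%g p = p ;
    actM : forall g h p, act (g * h)%g p = act g (act h p) ;
    act_isom : forall g p q, mdist (act g p) (act g q) = mdist p q }.

Section Action.
Context {R : realType} {G : groupType} {X : metricType R}.
Variables (a : isometric_action G X) (o : X).
Implicit Types (g h : G) (xi : boundary o).

Lemma actK g : cancel (a g) (a g^-1%g).
Proof. by move=> p; rewrite -actM mulVg act1. Qed.

Lemma actKV g : cancel (a g^-1%g) (a g).
Proof. by move=> p; rewrite -actM mulgV act1. Qed.

Lemma asymptotic_act g x y :
  asymptotic o x y -> asymptotic o (a g \o x) (a g \o y).
Proof.
have H p : mdist p o - mdist o (a g o) <= mdist (a g p) o.
  have := metric_triangle (a g p) o (a g o); rewrite act_isom.
  by lra.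
by apply: asymptotic_shift => // i j /=; exact: act_isom.
Qed.

Lemma image_asymptotic_class g x :
  [set a g \o y | y in asymptotic_class o x] = asymptotic_class o (a g \o x).
Proof.
apply/seteqP; split=> [_ [y [yy xy] <-]|y [yy xy]].
  by split; exact: asymptotic_act.
exists (a g^-1%g \o y); last by apply/funext => n /=; rewrite actKV.
split; first exact: asymptotic_act.
have := asymptotic_act g^-1%g xy.
by congr (asymptotic _ _ _); apply/funext => n /=; rewrite actK.
Qed.

Lemma boundary_act_subproof g xi :
  exists2 x, gromov_seq o x &
    [set a g \o y | y in boundary_seqs xi] = asymptotic_class o x.
Proof.
have [x xx ->] := boundary_seqsP xi; exists (a g \o x).
  exact: asymptotic_act.
exact: image_asymptotic_class.
Qed.

Definition boundary_act g xi : boundary o :=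
  Boundary (boundary_act_subproof g xi).

Definition orbit : set X := [set a g o | g in [set: G]].

Definition limit_set : set (boundary o) :=
  [set xi | closure [set Inside p | p in orbit] (AtInfinity xi)].

Definition translation_length g : R :=
  limn (fun n : nat => mdist (a (g ^+ n)%g o) o / n%:R).

Definition hyperbolic_element g := 0 < translation_length g.

Definition boundary_fix g : set (boundary o) :=
  [set xi | boundary_act g xi = xi].

Definition non_elementary :=
  exists g h, [/\ hyperbolic_element g, hyperbolic_element h &
                  boundary_fix g `&` boundary_fix h = set0].

Lemma mdist_conjg g h :
  `|mdist (a (g ^ h)%g o) o - mdist (a g o) o| <= 2 * mdist (a h o) o.
Proof.
set p := a h o; set q := a g p.
have -> : mdist (a (g ^ h)%g o) o = mdist q p.
  by rewrite conjgE !actM -(act_isom a h) actKV.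
have qo : mdist q (a g o) = mdist p o by exact: act_isom.
rewrite ler_norml; apply/andP; split.
- have := metric_triangle (a g o) q o; have := metric_triangle q p o.
  by rewrite (metric_sym (a g o) q) qo; lra.
- have := metric_triangle q (a g o) p; have := metric_triangle (a g o) o p.
  by rewrite (metric_sym o p) qo; lra.
Qed.

Lemma translation_length_conj g h :
  translation_length (g ^ h)%g = translation_length g.
Proof.
pose u k n := mdist (a (k ^+ n)%g o) o / n%:R : R.
have inv0 : (n%:R^-1 : R) @[n --> \oo] --> (0 : R).
  by rewrite -cvg_shiftS; exact: cvg_harmonic.
have cvg0 k l : u (k ^ l)%g n - u k n @[n --> \oo] --> (0 : R).
  apply: norm_cvg0.
  have C0 : 2 * mdist (a l o) o * (n%:R)^-1 @[n --> \oo] --> (0 : R).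
    by rewrite -(mulr0 (2 * mdist (a l o) o)); apply: cvgMl_tmp.
  apply: (squeeze_cvgr _ (cvg_cst 0) C0).
  apply: nearW => n; rewrite normr_ge0 /= /u -mulrBl normrM normfV normr_nat.
  by rewrite -conjXg ler_wpM2r ?invr_ge0 ?ler0n// mdist_conjg.
have cvgJ k l (L : R) : u k n @[n --> \oo] --> L ->
    u (k ^ l)%g n @[n --> \oo] --> L.
  move=> kL; have -> : u (k ^ l)%g = (fun n => u k n + (u (k ^ l)%g n - u k n)).
    by apply/funext => n; rewrite addrC subrK.
  by rewrite -[L]addr0; exact: cvgD kL (cvg0 k l).
have [/cvg_ex[L gL]|gN] := pselect (cvgn (u g)).
  by rewrite /translation_length (cvg_lim _ gL)// (cvg_lim _ (cvgJ _ h _ gL)).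
rewrite /translation_length (dvgP gN) dvgP// => /cvg_ex[L] /(cvgJ _ h^-1%g).
by rewrite conjgK => gL; apply: gN; apply/cvg_ex; exists L.
Qed.

End Action.

Arguments limit_set {R G X} a o.
Arguments boundary_act {R G X} a {o} g xi.

Section PrimitiveClasses.
Context {G : groupType}.
Implicit Types (g : G) (c : set G).

(* Powers with exponent in Z: [g ^- n] is the power of exponent [- n]. *)
Definition primitive g :=
  forall (h : G) (n : nat), (1 < n)%N -> g <> (h ^+ n)%g /\ g <> (h ^- n)%g.

Definition conj_class g : set G := [set (g ^ h)%g | h in [set: G]].

Definition primitive_classes : set (set G) :=
  [set conj_class g | g in primitive].

End PrimitiveClasses.

Section ClassLength.
Context {R : realType} {G : groupType} {X : metricType R}.
Variables (a : isometric_action G X) (o : X).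

(* The common translation length of the elements of a conjugacy class,
   read off on an arbitrary element of it; see [class_lengthE]. *)
Definition class_length (c : set G) : R := translation_length a o (xget 1%g c).

Lemma class_lengthE g : class_length (conj_class g) = translation_length a o g.
Proof.
have : conj_class g (xget 1%g (conj_class g)).
  by apply: (@xgetPex _ 1%g); exists g, 1%g => //; rewrite conjg1.
by rewrite /class_length => -[h _ <-]; exact: translation_length_conj.
Qed.

(* The limit over primitive classes as the length tends to infinity is taken
   along this filter; it is proper exactly when there are primitive classes of
   arbitrarily large length, without which the limit is not meaningful. *)
Definition long_primitive_classes : set_system (set G) :=
  filter_from [set: R]
    (fun M => [set c | primitive_classes c /\ M < class_length c]).

End ClassLength.

(* Main.v *)
Require Import Defs.
From mathcomp Require Import all_boot all_order all_algebra.
From mathcomp Require Import all_classical all_reals all_analysis.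
From mathcomp Require Import ring lra zify.
Import Order.TTheory GRing.Theory Num.Theory.
Import numFieldNormedType.Exports.
Local Open Scope classical_set_scope.
Local Open Scope ring_scope.

(** Call an element of G loxodromic for an action if its translation length is
    positive, and write l1, l2 for the two translation lengths.

    Long primitive elements are loxodromic for both actions, and their length
    ratio l1/l2 tends to 1. So it is enough to show two things.

    - The ratio l1/l2 is the same for all elements that are loxodromic for
      both actions: by [no_skew], two such elements cannot have
      l1 g / l2 g < l1 h / l2 h.
    - An element that is loxodromic for one action is loxodromic for the other:
      [lox_transfer].

    For the first point, conjugate g so that g and h have no common endpoint in
    either boundary ([independent_conjugate]; this is possible because all
    orbits on the boundaries are infinite). Then w = g^N h^M has length
    N l(g) + M l(h) + O(1) for both actions. Choose M as the integer part of
    rho N. If w were primitive for infinitely many N, for two different values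
    of rho, the hypothesis on ratios would give
    l1 g + rho l1 h = l2 g + rho l2 h for both values, hence l1 = l2 at g and at
    h, against the assumption on g and h. A group may however have few primitive
    elements, and it remains to treat the case where w is a proper power for all
    large N. This is where the boundary map is used.

    If w = u^n with n >= 2, then v = u^(n/2) translates along the quasi-axis of w
    by a fraction between 1/3 and 1/2 of the period ([axis_shift]), the same
    fraction for both actions. The quasi-axis of w consists of blocks g^N and
    h^M in turn, and the relative lengths of these blocks in X and in Y
    differ because the ratios of g and h differ. Take P such that in X the
    translation v carries the point g^P o close to the corner g^N o, and put
    e = g^(-N) v g^P. In X, e moves o a bounded distance, and it carries the
    ray of g near to the ray of h for a long time. In Y, v misses the corner by
    a distance that grows linearly with N, so that e acts near o like a large
    negative power of g ([slips]). Let h+ be the attracting point of h in the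
    boundary of X. As N and then m tend to infinity, e g^m h+ converges to h+,
    whereas its image under f converges to the repelling point of g. By
    continuity f sends h+ to the repelling point of g. But f(h+) is fixed by h,
    and g and h have no common endpoint: this is [no_slip].

    For the second point, let l1 h > 0 and l2 h = 0, and take two independent
    conjugates g and k of an element that is loxodromic for both actions. One of
    g^n h^n and g^n k^n h^n is loxodromic in Y ([one_of_two_lox]). Its two
    lengths are then equal by the first point, but h^n contributes n l1(h) to the
    first and only o(n) to the second. *)

Set Implicit Arguments.
Unset Strict Implicit.
Unset Printing Implicit Defensive.

Local Notation gp := gromov_product.

(** * Gromov products and chains of points *)

Section GromovProductFacts.
Context {R : realType} {X : metricType R}.
Implicit Types (o p q r : X).

Lemma gpC o p q : gp o p q = gp o q p.
Proof. by rewrite /gp (metric_sym p q) (addrC (mdist p o)). Qed.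

Lemma gp_ge0 o p q : 0 <= gp o p q.
Proof.
have := metric_triangle p o q; rewrite (metric_sym o q) /gp; lra.
Qed.

Lemma gp_le o p q : gp o p q <= mdist p o.
Proof.
have := metric_triangle q p o; rewrite (metric_sym q p) /gp; lra.
Qed.

Lemma gp_base o o' p q : gp o p q <= gp o' p q + mdist o o'.
Proof.
have := metric_triangle p o' o; have := metric_triangle q o' o.
rewrite (metric_sym o' o) /gp; lra.
Qed.

Lemma gp_point o p p' q : gp o p q <= gp o p' q + mdist p p'.
Proof.
have := metric_triangle p p' o; have := metric_triangle p' p q.
rewrite (metric_sym p' p) /gp; lra.
Qed.

Lemma gp_ge o p q : mdist p o - mdist p q <= gp o p q.
Proof.
have := metric_triangle p q o; rewrite /gp; lra.
Qed.

Lemma gp_swap o p q : gp o p q = mdist o p - gp p o q.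
Proof.
rewrite /gp (metric_sym p o) (metric_sym q o) (metric_sym q p); lra.
Qed.

Lemma gp_xx o p : gp o p p = mdist p o.
Proof. by rewrite /gp mdistxx; lra. Qed.

Lemma gp_self o p : gp o o p = 0.
Proof. by rewrite /gp mdistxx (metric_sym p o); lra. Qed.

End GromovProductFacts.

Section Hyperbolic.
Context {R : realType} {X : metricType R} (delta : R).
Hypothesis hyp : delta_hyperbolic (X := X) delta.
Hypothesis delta_gt0 : 0 < delta.
Implicit Types (o p q r x y z : X).

Lemma gp_trans_ge o p q r T :
  T <= gp o p r -> T <= gp o r q -> T - delta <= gp o p q.
Proof.
move=> h1 h2; apply: le_trans (hyp o p q r).
by rewrite lerD2r le_min h1 h2.
Qed.

Lemma gp_trans_le o p q r c :
  gp o p r <= c -> c + delta < gp o p q -> gp o q r <= c + delta.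
Proof.
move=> h1 h2; rewrite leNgt; apply/negP => h3.
have := hyp o p r q; rewrite lerBlDr => h.
have : c + delta < Num.min (gp o p q) (gp o q r) by rewrite lt_min h2 h3.
lra.
Qed.

(** Replacing the two arguments of a Gromov product at o by points that o sees in
    almost the same directions increases it by 2 delta at most. *)
Lemma gp_move_le o p q p' q' c : gp o p q <= c ->
  c + 2 * delta < gp o p p' -> c + 2 * delta < gp o q q' ->
  gp o p' q' <= c + 2 * delta.
Proof.
have dg := delta_gt0 => h hp hq.
have h1 : gp o q p' <= c + delta.
  by rewrite gpC; apply: (@gp_trans_le _ p) => //; lra.
rewrite (_ : c + 2 * delta = c + delta + delta); last by lra.
by rewrite gpC; apply: (@gp_trans_le _ q) => //; lra.
Qed.

(** The four-point inequality is hyperbolicity with the base point expanded: of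
    the three ways to pair four points, the two largest sums almost agree. *)
Lemma four_point x y z t :
  mdist x z + mdist y t <=
    Num.max (mdist x y + mdist z t) (mdist x t + mdist y z) + 2 * delta.
Proof.
have := hyp x y t z; rewrite lerBlDr => h.
rewrite -lerBlDr le_max; apply/orP.
move: h; rewrite /gp ge_min (metric_sym y x) (metric_sym z x) (metric_sym t x).
case/orP => h; [right|left]; lra.
Qed.

(** Local-to-global principle: consecutive points that are far apart, with small
    Gromov products at the corners, form a quasi-geodesic. The space need not be
    geodesic, so such chains replace geodesics throughout. *)
Section Chain.
Variables (kappa : R) (x : nat -> X).
Hypothesis kappa_ge0 : 0 <= kappa.
Hypothesis turn : forall i, gp (x i.+1) (x i) (x i.+2) <= kappa.
Hypothesis long : forall i, 2 * kappa + 3 * delta < mdist (x i) (x i.+1).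

(* The turn at the last corner is small, and the previous bound shows that the
   start of the chain is seen from there in the direction of the last step. *)
Let forward i n : gp (x (i + n).+1) (x i) (x (i + n).+2) <= kappa + delta.
Proof.
elim: n => [|n IH].
  by rewrite addn0; apply: le_trans (turn i) _; rewrite lerDl ltW.
rewrite addnS; set k := (i + n).+1.
apply: (@gp_trans_le _ (x k)); first exact: turn.
have := gp_swap (x k) (x k.+1) (x i); have := long k.
rewrite (gpC (x k)) => h1 h2; move: IH; rewrite -/k => h3. have dg := delta_gt0. lra.
Qed.

Let backward n i : gp (x i.+1) (x i) (x (i + n).+2) <= kappa + delta.
Proof.
elim: n i => [|n IH] i.
  by rewrite addn0; apply: le_trans (turn i) _; rewrite lerDl ltW.
rewrite gpC addnS; apply: (@gp_trans_le _ (x i.+2)).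
  by rewrite gpC; exact: turn.
have := gp_swap (x i.+2) (x i.+1) (x (i + n).+3); have := long i.+1.
have := IH i.+1; rewrite addSn (metric_sym (x i.+2)) => h1 h2 h3; have dg := delta_gt0; lra.
Qed.

Lemma chain_gp i j k : (i <= j)%N -> (j <= k)%N ->
  gp (x j) (x i) (x k) <= kappa + 2 * delta.
Proof.
have dg := delta_gt0; have kg := kappa_ge0.
rewrite leq_eqVlt => /orP[/eqP <- _|ij]; first by rewrite gp_self; lra.
rewrite leq_eqVlt => /orP[/eqP <-|jk]; first by rewrite gpC gp_self; lra.
case: j ij jk => // j; rewrite ltnS => ij jk.
have F : gp (x j.+1) (x i) (x j.+2) <= kappa + delta.
  by have := forward i (j - i); rewrite subnKC.
case: (ltnP j.+2 k) => [jk2|]; last first.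
  move=> kj; have -> : k = j.+2 by apply/eqP; rewrite eqn_leq kj jk.
  lra.
rewrite (_ : kappa + 2 * delta = kappa + delta + delta); last by lra.
rewrite gpC; apply: (@gp_trans_le _ (x j.+2)); first by rewrite gpC.
have := backward (k - j.+3) j.+1; rewrite addSn.
rewrite (_ : (j + (k - j.+3)).+3 = k); last by lia.
have := gp_swap (x j.+2) (x j.+1) (x k); have := long j.+1.
rewrite (metric_sym (x j.+2)); lra.
Qed.

Lemma chain_dist i j k : (i <= j)%N -> (j <= k)%N ->
  mdist (x i) (x j) + mdist (x j) (x k) - 2 * (kappa + 2 * delta)
    <= mdist (x i) (x k).
Proof.
move=> ij jk; have := chain_gp ij jk.
rewrite /gp (metric_sym (x k)); lra.
Qed.

End Chain.

(** Near a geodesic from z to z' the distance to z is, up to a bounded error, an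
    isometric coordinate. *)
Lemma line_dist c z z' x y : gp x z z' <= c -> gp y z z' <= c ->
  mdist x y <= `|mdist x z - mdist y z| + 2 * c + 2 * delta.
Proof.
move=> hx hy; have := four_point x z y z'.
rewrite -lerBlDr le_max (metric_sym z y) => h; move: hx hy; rewrite /gp.
rewrite (metric_sym z x) (metric_sym z' x) (metric_sym z y) (metric_sym z' y).
have := ler_norm (mdist x z - mdist y z).
have := ler_norm (- (mdist x z - mdist y z)); rewrite normrN.
case/orP: h => *; lra.
Qed.

End Hyperbolic.


(** * Displacement and translation length *)

Section Fekete.
Context {R : realType}.

Lemma nat_gt (x : R) : exists n : nat, x < n%:R.
Proof.
exists (Num.truncn x).+1; case: (lerP 0 x) => x0.
  by have /andP[] := truncn_itv x0.
by apply: lt_le_trans x0 _; rewrite ler0n.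
Qed.

Variable u : nat -> R.
Hypothesis u0 : u 0%N = 0.
Hypothesis u_ge0 : forall n, 0 <= u n.
Hypothesis u_sub : forall m n, u (m + n)%N <= u m + u n.

Lemma subadditive_mul n m : u (n * m)%N <= n%:R * u m.
Proof.
elim: n => [|n IH]; first by rewrite mul0n u0 mul0r.
rewrite mulSn -natr1 mulrDl mul1r addrC; apply: le_trans (u_sub _ _) _.
by rewrite lerD2l.
Qed.

(** Fekete's lemma: divide n by an index m where u m / m almost attains the
    infimum. *)
Lemma fekete : exists2 L : R, u n / n%:R @[n --> \oo] --> L &
  0 <= L /\ forall n, n%:R * L <= u n.
Proof.
pose A := [set u n.+1 / n.+1%:R | n in [set: nat]].
have lbA : lbound A 0 by move=> _ [n _ <-]; rewrite divr_ge0.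
have hA : has_inf A by split; [exists (u 1 / 1%:R), 0%N|exists 0].
have infA n : inf A <= u n.+1 / n.+1%:R.
  by apply: ge_inf; [exists 0|exists n].
exists (inf A); last first.
  split; first by apply: lb_le_inf => //; exists (u 1 / 1%:R), 0%N.
  by case=> [|n]; [rewrite mul0r u0|rewrite mulrC -ler_pdivlMr ?infA].
apply/cvgrPdist_lt => e e0.
have e20 : 0 < e / 2 by lra.
have [_ [m _ <-] hm] := inf_adherent e20 hA.
have [N hN] := nat_gt (2 * (m.+1%:R * u 1) / e).
exists N.+1 => // n /= Nn.
have n0 : (0 : R) < n%:R by rewrite ltr0n; lia.
have lo : inf A <= u n / n%:R by case: n {n0} Nn => // n _.
have hi : u n / n%:R < inf A + e.
  have : u n <= (n %/ m.+1)%:R * u m.+1 + m.+1%:R * u 1.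
    rewrite {1}(divn_eq n m.+1); apply: le_trans (u_sub _ _) _.
    apply: lerD; first exact: subadditive_mul.
    rewrite -[(n %% _)%N]muln1; apply: le_trans (subadditive_mul _ _) _.
    by rewrite ler_wpM2r// ler_nat ltnW// ltn_mod.
  have q1 : (n %/ m.+1)%:R * u m.+1 <= n%:R * (u m.+1 / m.+1%:R).
    rewrite mulrA [leRHS]mulrAC ler_wpM2r// ler_pdivlMr// -natrM ler_nat.
    exact: leq_trunc_div.
  have q2 : n%:R * (u m.+1 / m.+1%:R) < n%:R * (inf A + e / 2).
    by rewrite ltr_pM2l.
  have q3 : m.+1%:R * u 1 < n%:R * (e / 2).
    have : N%:R <= n%:R :> R by rewrite ler_nat ltnW.
    rewrite ltr_pdivrMr// in hN => /(ler_wpM2r (ltW e0)) Nn'; lra.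
  have {q1 q2} q4 := le_lt_trans q1 q2.
  move=> h; rewrite ltr_pdivrMr//; apply: le_lt_trans h _.
  rewrite [ltRHS]mulrC (splitr e) addrA mulrDr; exact: ltrD.
by rewrite distrC ger0_norm; lra.
Qed.

End Fekete.

Section Action.
Context {R : realType} {G : groupType} {X : metricType R}.
Variables (a : isometric_action G X) (o : X).
Implicit Types (g h r s v w : G) (n m : nat).

Definition displacement g : R := mdist (a g o) o.
Local Notation len := displacement.
Local Notation tl := (translation_length a o).

Lemma gp_act g (p q x : X) : gp (a g p) (a g q) (a g x) = gp p q x.
Proof. by rewrite /gp !act_isom. Qed.

Lemma len_dist g h : mdist (a g o) (a h o) = len (h^-1 * g)%g.
Proof. by rewrite /displacement actM -(act_isom a h (a _ _) o) actKV. Qed.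

Lemma len1 : len 1%g = 0.
Proof. by rewrite /displacement act1 mdistxx. Qed.

Lemma len_ge0 g : 0 <= len g. Proof. exact: mdist_ge0. Qed.

Lemma lenV g : len g^-1%g = len g.
Proof. by rewrite /displacement -(act_isom a g) actKV metric_sym. Qed.

Lemma lenM g h : len (g * h)%g <= len g + len h.
Proof.
rewrite /displacement actM addrC; apply: le_trans (metric_triangle _ (a g o) _) _.
by rewrite act_isom.
Qed.

Lemma len_exp_sub g m n : len (g ^+ (m + n))%g <= len (g ^+ m)%g + len (g ^+ n)%g.
Proof. by rewrite expgnDr lenM. Qed.

Lemma len_exp g n : len (g ^+ n)%g <= n%:R * len g.
Proof.
have := @subadditive_mul R (fun n => len (g ^+ n)%g) _ (len_exp_sub g) n 1.
by rewrite muln1 expg1; apply; rewrite expg0 len1.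
Qed.

Lemma len_expV g n : len (g^-1 ^+ n)%g = len (g ^+ n)%g.
Proof. by rewrite expVgn lenV. Qed.

Let fek g : len (g ^+ n)%g / n%:R @[n --> \oo] --> tl g /\
  0 <= tl g /\ forall n, n%:R * tl g <= len (g ^+ n)%g.
Proof.
have [] := @fekete R (fun n => len (g ^+ n)%g).
- by rewrite expg0 len1.
- by move=> n; exact: len_ge0.
- exact: len_exp_sub.
move=> L cL hL; suff -> : tl g = L by [].
by rewrite /translation_length (cvg_lim _ cL).
Qed.

Lemma tl_ge0 g : 0 <= tl g. Proof. by have [_ []] := fek g. Qed.

Lemma tl_le g n : n%:R * tl g <= len (g ^+ n)%g.
Proof. by have [_ []] := fek g. Qed.

Lemma tl_le_len g : tl g <= len g.
Proof. by have := tl_le g 1; rewrite mul1r expg1. Qed.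

(** For every isometry, loxodromic or not, powers grow at most at the rate of the
    translation length, up to a linear error that is arbitrarily small. *)
Lemma tl_upper g (e : R) : 0 < e ->
  exists N, forall n, (N <= n)%N -> len (g ^+ n)%g <= n%:R * (tl g + e).
Proof.
move=> e0; have [/cvgrPdist_lt/(_ e e0)[N _ hN] _] := fek g.
exists N.+1 => n Nn; have /hN/= : (N <= n)%N by exact: ltnW.
have n0 : (0 : R) < n%:R by rewrite ltr0n; lia.
rewrite ltr_norml => /andP[h _].
rewrite -ler_pdivrMl// mulrC; lra.
Qed.

Lemma tl_lower g (c K : R) :
  (forall n, n%:R * c - K <= len (g ^+ n)%g) -> c <= tl g.
Proof.
move=> h; rewrite leNgt; apply/negP => lt.
have [] := @tl_upper g ((c - tl g) / 2); first by lra.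
move=> N hN; have [M hM] := nat_gt (2 * K / (c - tl g)).
have := hN (N + M)%N (leq_addr _ _); have := h (N + M)%N.
rewrite ltr_pdivrMr in hM; last by lra.
have : M%:R * (c - tl g) <= (N + M)%:R * (c - tl g).
  by rewrite ler_wpM2r ?ler_nat ?leq_addl//; lra.
lra.
Qed.

Lemma tl_exp g k : tl (g ^+ k)%g = k%:R * tl g.
Proof.
apply/eqP; rewrite eq_le; apply/andP; split; last first.
  apply: (@tl_lower _ _ 0) => n; rewrite subr0 -expgnA mulnC mulrA -natrM.
  exact: tl_le.
rewrite leNgt; apply/negP => lt.
have [k0|k0] := posnP k.
  by have := tl_le_len 1%g; move: lt; rewrite k0 mul0r expg0 len1; lra.
set e := (tl (g ^+ k)%g - k%:R * tl g) / k.+1%:R.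
have k0' : (0 : R) < k%:R by rewrite ltr0n.
have e0 : 0 < e by rewrite divr_gt0// subr_gt0.
have [N hN] := tl_upper g e0.
have := hN (k * N.+1)%N; rewrite (leq_trans (leqnSn _) (leq_pmull _ k0)) => /(_ isT).
rewrite expgnA => h; have := le_trans (tl_le _ _) h.
rewrite mulnC natrM -mulrA ler_pM2l// mulrDr.
suff : k%:R * e < tl (g ^+ k)%g - k%:R * tl g by lra.
rewrite /e mulrCA gtr_pMr; last by lra.
by rewrite ltr_pdivrMr// mul1r ltr_nat.
Qed.

Lemma tl_inv g : tl g^-1%g = tl g.
Proof.
rewrite /translation_length; congr (limn _); apply/funext => n.
by have := len_expV g n; rewrite /displacement => ->.
Qed.

(** Almost superadditive powers have almost additive lengths. *)
Lemma tl_quasi w (K : R) :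
  (forall n, len (w ^+ n)%g + len w - K <= len (w ^+ n.+1)%g) ->
  len w - K <= tl w.
Proof.
move=> h; apply: (@tl_lower _ _ 0) => n; rewrite subr0.
elim: n => [|n IH]; first by rewrite mul0r len_ge0.
by apply: le_trans (h n); rewrite -natr1 mulrDl mul1r -addrA lerD2r.
Qed.

End Action.


(** * Quasi-axes of loxodromic isometries *)

Section Loxodromic.
Context {R : realType} {G : groupType} {X : metricType R}.
Variables (a : isometric_action G X) (o : X) (delta : R).
Hypothesis hyp : delta_hyperbolic (X := X) delta.
Hypothesis delta_gt0 : 0 < delta.
Implicit Types (g h r s v w : G) (n m i j k : nat) (p q : X).
Local Notation len := (displacement a o).
Local Notation tl := (translation_length a o).

Lemma act_commute g h p : commute g h -> a g (a h p) = a h (a g p).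
Proof. by move=> gh; rewrite -!actM gh. Qed.

Lemma actXC v k p : a v (a (v ^+ k)%g p) = a (v ^+ k)%g (a v p).
Proof. by apply: act_commute; apply: commuteX. Qed.

Lemma gp_expg g i j : gp o (a (g^-1 ^+ i)%g o) (a (g ^+ j)%g o) =
  (len (g ^+ i)%g + len (g ^+ j)%g - len (g ^+ (i + j))%g) / 2.
Proof.
rewrite /gp -!/(displacement _ _ _) -!/(len _) len_expV; congr ((_ - _) / 2).
rewrite len_dist expVgn -[in LHS]lenV invgM !invgK -expgnDr; congr (len _).
Qed.

(** The orbit of o under the powers of g is a quasi-geodesic: the backward and
    forward half-orbits diverge at o. *)
Definition quasi_axis (K : R) g :=
  forall i j, gp o (a (g^-1 ^+ i)%g o) (a (g ^+ j)%g o) <= K.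

Lemma quasi_axisV K g : quasi_axis K g -> quasi_axis K g^-1%g.
Proof. by move=> h i j; rewrite invgK gpC. Qed.

Lemma quasi_axis_le K K' g : K <= K' -> quasi_axis K g -> quasi_axis K' g.
Proof. by move=> KK h i j; apply: le_trans KK. Qed.

(** The lengths of powers are almost additive, which bounds the length of a power
    from above by its translation length. *)
Lemma quasi_axis_len K g n : quasi_axis K g ->
  len (g ^+ n)%g <= n%:R * tl g + 2 * K.
Proof.
move=> h; rewrite -tl_exp -lerBlDr; apply: tl_quasi => m.
rewrite -expgnA -expgnA mulnS addnC.
have := h (n * m)%N n; rewrite gp_expg; lra.
Qed.

Lemma gp_ray K g i j : quasi_axis K g -> (i <= j)%N ->
  i%:R * tl g - K <= gp o (a (g ^+ i)%g o) (a (g ^+ j)%g o).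
Proof.
move=> h ij; rewrite /gp -!/(displacement _ _ _) -!/(len _).
have -> : mdist (a (g ^+ i)%g o) (a (g ^+ j)%g o) = len (g ^+ (j - i))%g.
  rewrite metric_sym len_dist; congr (len _).
  by rewrite -{1}(subnKC ij) expgnDr mulKg.
have := tl_le a o g i; have := tl_le a o g j.
have := quasi_axis_len (j - i) h; rewrite natrB// mulrBl; lra.
Qed.

(** The orbit of o under v is a chain all of whose corners are congruent. *)
Lemma quasi_axisP v kappa : 0 <= kappa ->
  gp o (a v^-1%g o) (a v o) <= kappa -> 2 * kappa + 3 * delta < len v ->
  quasi_axis (kappa + 2 * delta) v.
Proof.
move=> k0 hk hl i j; pose x n := a (v ^+ n)%g o.
have sh n p : a (v ^+ n.+1)%g p = a (v ^+ n)%g (a v p) by rewrite expgSr actM.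
have := @chain_gp R X delta hyp delta_gt0 kappa x k0 _ _ 0 i (i + j).
rewrite leq0n leq_addr /x expg0 act1 => /(_ _ _ isT isT) H.
rewrite -(gp_act a (v ^+ i)%g) -!actM expVgn mulgV act1 -expgnDr.
apply: H => n.
  by rewrite !sh gp_act -(gp_act a v^-1%g) !actK.
by rewrite metric_sym sh act_isom.
Qed.

(** Some power g^p satisfies the hypothesis of [quasi_axisP]: for large p the
    length of g^p is close to p tl g, and that of g^(2p) is at least 2p tl g. The
    powers in between stay within p len g of those of g^p. *)
Lemma lox_axis g : 0 < tl g -> exists2 K, 0 <= K & quasi_axis K g.
Proof.
move=> g0; have dg := delta_gt0.
have g20 : 0 < tl g / 2 by lra.
have [N hN] := tl_upper a o g g20.
have [M hM] := nat_gt (3 * delta / (tl g / 2)).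
set p := (N + M).+1.
have lp := hN p (leq_trans (leq_addr _ _) (leqnSn _)).
have l2p := tl_le a o g (p + p); rewrite natrD in l2p.
have pM : 3 * delta < p%:R * (tl g / 2).
  have : M%:R <= p%:R :> R by rewrite ler_nat; lia.
  by move=> /(ler_wpM2r (ltW g20)); rewrite ltr_pdivrMr// in hM; lra.
set kappa := gp o (a (g ^+ p)^-1%g o) (a (g ^+ p)%g o).
have kE := gp_expg g p p; rewrite expVgn -/kappa in kE.
have k0 : 0 <= kappa by exact: gp_ge0.
have ax : quasi_axis (kappa + 2 * delta) (g ^+ p)%g.
  by apply: quasi_axisP => //; lra.
have gl := len_ge0 a o g.
exists (kappa + 2 * delta + (p%:R * len g) *+ 2).
  rewrite addr_ge0 ?mulrn_wge0 ?mulr_ge0//; lra.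
have red g' m : mdist (a (g' ^+ m)%g o) (a ((g' ^+ p) ^+ (m %/ p))%g o) <=
    p%:R * len g'.
  rewrite len_dist {2}(divn_eq m p) expgnDr mulnC expgnA mulKg.
  apply: le_trans (len_exp _ _ _ _) _; rewrite ler_wpM2r ?len_ge0// ler_nat ltnW//.
  by rewrite ltn_mod.
move=> i j; apply: le_trans (gp_point _ _ (a ((g^-1 ^+ p) ^+ (i %/ p))%g o) _) _.
rewrite mulr2n addrA; apply: lerD; last by rewrite -(lenV _ _ g).
rewrite gpC; apply: le_trans (gp_point _ _ (a ((g ^+ p) ^+ (j %/ p))%g o) _) _.
by apply: lerD => //; rewrite gpC expVgn.
Qed.

End Loxodromic.


(** * Products of two isometries that turn little *)

Section TwoBlocks.
Context {R : realType} {G : groupType} {X : metricType R}.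
Variables (a : isometric_action G X) (o : X) (delta : R).
Hypothesis hyp : delta_hyperbolic (X := X) delta.
Hypothesis delta_gt0 : 0 < delta.
Implicit Types (g h v w : G) (n m i j k : nat) (p q z : X).
Local Notation len := (displacement a o).
Local Notation tl := (translation_length a o).

(** For large m the orbit points w^(-m) o and w^m o stand for the ends of the axis
    of w: p lies near the axis, at position t after o in the direction of w. *)
Definition on_axis w c p (t : R) := forall m, (0 < m)%N ->
  gp p (a (w^-1 ^+ m)%g o) (a (w ^+ m)%g o) <= c /\
  `|mdist p (a (w^-1 ^+ m)%g o) - len (w ^+ m)%g - t| <= c.

Variables (r s : G) (kappa : R).
Hypothesis kappa_ge0 : 0 <= kappa.
Hypothesis turn_rs : gp o (a r^-1%g o) (a s o) <= kappa.
Hypothesis turn_sr : gp o (a s^-1%g o) (a r o) <= kappa.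
Hypothesis long_r : 2 * kappa + 3 * delta < len r.
Hypothesis long_s : 2 * kappa + 3 * delta < len s.
Local Notation w := (r * s)%g.
Local Notation K := (kappa + 2 * delta).

(* The chain o, r o, rs o, rsr o, ... *)
Let corner n : X := a (w ^+ (n./2))%g (if odd n then a r o else o).

Let corner_even n : corner (n * 2)%N = a (w ^+ n)%g o.
Proof. by rewrite /corner muln2 doubleK odd_double. Qed.

Let corner_odd n : corner (n * 2).+1 = a (w ^+ n)%g (a r o).
Proof. by rewrite /corner muln2 -addn1 -[(n.*2 + 1)%N]addnC halfD /= odd_double /= doubleK. Qed.

Let corner_parity n : exists k, n = (k * 2)%N \/ n = (k * 2).+1.
Proof.
exists n./2; rewrite -{1 3}(odd_double_half n) muln2.
by case: odd; [right|left].
Qed.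

Let expS n p : a (w ^+ n.+1)%g p = a (w ^+ n)%g (a r (a s p)).
Proof. by rewrite expgSr !actM. Qed.

Let corner_turn i : gp (corner i.+1) (corner i) (corner i.+2) <= kappa.
Proof.
have [k [->|->]] := corner_parity i.
  rewrite (_ : (k * 2).+2 = k.+1 * 2)%N; last by rewrite mulSn.
  rewrite corner_odd !corner_even expS gp_act.
  by rewrite -(gp_act a r^-1%g) !actK.
rewrite (_ : (k * 2).+2 = k.+1 * 2)%N; last by rewrite mulSn.
rewrite !corner_odd corner_even !expS gp_act gp_act.
by rewrite -(gp_act a s^-1%g) !actK.
Qed.

Let corner_long i : 2 * kappa + 3 * delta < mdist (corner i) (corner i.+1).
Proof.
have [k [->|->]] := corner_parity i.
  by rewrite corner_odd corner_even act_isom metric_sym.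
rewrite (_ : (k * 2).+2 = k.+1 * 2)%N; last by rewrite mulSn.
by rewrite corner_odd corner_even expS !act_isom metric_sym.
Qed.

Let corner_dist i j k : (i <= j)%N -> (j <= k)%N ->
  mdist (corner i) (corner j) + mdist (corner j) (corner k) - 2 * K
    <= mdist (corner i) (corner k).
Proof.
exact: (chain_dist hyp delta_gt0 kappa_ge0 corner_turn corner_long).
Qed.

Lemma two_blocks_len : len r + len s - 2 * K <= len w.
Proof.
have := corner_dist (leq0n 1) (leqnSn 1).
rewrite (corner_even 0) (corner_odd 0) (corner_even 1) expg0 expg1 !act1.
rewrite actM act_isom -/(displacement a o s) /displacement actM.
by rewrite (metric_sym o) (metric_sym _ (a s o)) (metric_sym o) ?(metric_sym _ o).
Qed.

(** The path from o to w^(m+k+1) o passes near the corners w^m o, w^m r o and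
    w^(m+1) o. *)
Lemma two_blocks_decomp m k :
  len (w ^+ m)%g + len r + len s + len (w ^+ k)%g - 6 * K <=
    len (w ^+ (m + k).+1)%g.
Proof.
have e1 : (m * 2 <= (m + k).+1 * 2)%N by lia.
have e2 : ((m * 2).+1 <= (m + k).+1 * 2)%N by lia.
have e3 : (m.+1 * 2 <= (m + k).+1 * 2)%N by lia.
have e4 : ((m * 2).+1 <= m.+1 * 2)%N by lia.
have := corner_dist (leq0n (m * 2)) e1.
have := corner_dist (leqnSn (m * 2)) e2.
have := corner_dist e4 e3.
rewrite (corner_even 0) !corner_even !corner_odd expg0 act1.
rewrite !(metric_sym o).
have -> : mdist (a (w ^+ m.+1)%g o) (a (w ^+ (m + k).+1)%g o) = len (w ^+ k)%g.
  by rewrite metric_sym len_dist -addSn expgnDr mulKg.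
have -> : mdist (a (w ^+ m)%g (a r o)) (a (w ^+ m.+1)%g o) = len s.
  by rewrite expS !act_isom metric_sym.
have -> : mdist (a (w ^+ m)%g o) (a (w ^+ m)%g (a r o)) = len r.
  by rewrite act_isom metric_sym.
rewrite /displacement; lra.
Qed.

Lemma two_blocks_step n : len (w ^+ n)%g + len w - 2 * K <= len (w ^+ n.+1)%g.
Proof.
have e1 : (n * 2 <= n.+1 * 2)%N by lia.
have := corner_dist (leq0n (n * 2)) e1.
rewrite (corner_even 0) !corner_even expg0 act1 !(metric_sym o).
suff -> : mdist (a (w ^+ n)%g o) (a (w ^+ n.+1)%g o) = len w by [].
by rewrite metric_sym len_dist expgSr mulKg.
Qed.

Lemma two_blocks_tl : len r + len s - 4 * K <= tl w.
Proof. have := tl_quasi two_blocks_step; have := two_blocks_len; lra. Qed.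

Let ends m : mdist (a (w^-1 ^+ m)%g o) (a (w ^+ m)%g o) = len (w ^+ (m + m))%g.
Proof. by rewrite metric_sym len_dist expVgn invgK expgnDr. Qed.

Let endP m p : mdist p (a (w^-1 ^+ m)%g o) <= mdist p o + len (w ^+ m)%g.
Proof.
rewrite -len_expV /displacement (metric_sym (a _ o) o); exact: metric_triangle.
Qed.

Lemma on_axis_first c p : 0 <= c -> gp p o (a r o) <= c ->
  on_axis w (2 * c + 6 * K) p (mdist p o).
Proof.
have dg := delta_gt0; have kg := kappa_ge0.
move=> c0 hp [//|m] _; have := two_blocks_decomp m.+1 m.
rewrite -addnS -ends; set z := a _ o; set z' := a _ o => hz.
have h1 := endP m.+1 p; rewrite -/z in h1.
have h2 : mdist p z' <= mdist p (a r o) + (len s + len (w ^+ m)%g).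
  apply: le_trans (metric_triangle _ (a r o) _) _; rewrite lerD2l.
  rewrite /z' expgS !actM (act_isom a r) /displacement.
  rewrite (metric_sym (a s o)) (metric_sym (a (w ^+ m)%g o)).
  by apply: le_trans (metric_triangle _ (a s o) _) _; rewrite act_isom.
have h3 := metric_triangle z p z'; rewrite (metric_sym z p) in h3.
move: hp; rewrite /gp (metric_sym o p) (metric_sym (a r o) p) (metric_sym o (a r o)).
rewrite -/(displacement a o r) (metric_sym z p) (metric_sym z' p) => hp.
split; [|rewrite ler_norml; apply/andP; split]; lra.
Qed.

Lemma on_axis_second c p : 0 <= c -> gp p o (a s o) <= c ->
  on_axis w (2 * c + 6 * K) (a r p) (len r + mdist p o).
Proof.
have dg := delta_gt0; have kg := kappa_ge0.
move=> c0 hp [//|m] _; have := two_blocks_decomp m.+1 m.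
rewrite -addnS -ends; set z := a _ o; set z' := a _ o => hz.
have h1 := endP m.+1 (a r p); rewrite -/z in h1.
have h0 : mdist (a r p) o <= mdist p o + len r.
  by rewrite -(act_isom a r p); exact: metric_triangle.
have h2 : mdist (a r p) z' <= mdist p (a s o) + len (w ^+ m)%g.
  rewrite /z' expgS !actM (act_isom a r).
  apply: le_trans (metric_triangle _ (a s o) _) _; rewrite lerD2l act_isom.
  by rewrite metric_sym.
have h3 := metric_triangle z (a r p) z'; rewrite (metric_sym z (a r p)) in h3.
move: hp; rewrite /gp (metric_sym o p) (metric_sym (a s o) p) (metric_sym o (a s o)).
rewrite -/(displacement a o s) (metric_sym z _) (metric_sym z' _) => hp.
split; [|rewrite ler_norml; apply/andP; split]; lra.
Qed.

Lemma on_axis_ends m : gp o (a (w^-1 ^+ m)%g o) (a (w ^+ m)%g o) <= 3 * K.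
Proof.
rewrite gp_expg; case: m => [|m].
  by have dg := delta_gt0; have kg := kappa_ge0; rewrite expg0 len1; lra.
have := two_blocks_decomp m.+1 m; rewrite -addnS.
have : len (w ^+ m.+1)%g <= len w + len (w ^+ m)%g by rewrite expgS lenM.
have := lenM a o r s; lra.
Qed.

End TwoBlocks.


(** * Roots of a loxodromic isometry *)

Section Roots.
Context {R : realType} {G : groupType} {X : metricType R}.
Variables (a : isometric_action G X) (o : X) (delta : R).
Hypothesis hyp : delta_hyperbolic (X := X) delta.
Hypothesis delta_gt0 : 0 < delta.
Implicit Types (g h v w : G) (n m i j k : nat) (p q z : X).
Local Notation len := (displacement a o).
Local Notation tl := (translation_length a o).

Lemma tl_unbounded v (B : R) : 0 < tl v ->
  exists n0, forall n, (n0 <= n)%N -> B < len (v ^+ n)%g.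
Proof.
move=> v0; have [n0 h] := nat_gt (B / tl v); exists n0 => n n0n.
apply: lt_le_trans (tl_le a o v n); rewrite ltr_pdivrMr// in h.
by apply: lt_le_trans h _; rewrite ler_wpM2r ?ler_nat// ltW.
Qed.

(** A bound at arbitrarily large exponents k gives one at all exponents, with a
    constant that does not depend on v. The points v^(-1) o, o
    and v o all lie near the line from v^(-k) o to v^k o, so they are either in
    this order, or v^(-1) o and v o are close; the latter would make the
    translation length small. *)
Lemma root_axis v (C : R) : 0 <= C -> 4 * C + 15 * delta < tl v ->
  (forall n0, exists k, (n0 <= k)%N /\
     gp o (a (v^-1 ^+ k)%g o) (a (v ^+ k)%g o) <= C) ->
  quasi_axis a o (2 * C + 8 * delta) v.
Proof.
have dg := delta_gt0; move=> C0 v_long hC.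
have v0 : 0 < tl v by lra.
have [n0 hn0] := tl_unbounded (C + 2 * delta + len v) v0.
have [k [/hn0 len_k hk]] := hC n0.
set z := a (v^-1 ^+ k)%g o in hk; set z' := a (v ^+ k)%g o in hk.
have zo : mdist z o = len (v ^+ k)%g by rewrite -len_expV.
have z'o : mdist z' o = len (v ^+ k)%g by [].
have vz u : commute u v -> mdist z (a u z) = len u.
  move=> uv; rewrite /z act_commute ?act_isom ?(metric_sym o)//.
  by apply: commuteX; apply: commuteV.
have vz' u : commute u v -> mdist z' (a u z') = len u.
  move=> uv; rewrite /z' act_commute ?act_isom ?(metric_sym o)//.
  exact: commuteX.
have cv : commute v^-1%g v by apply: commute_sym; apply: commuteV.
have near u : commute u v -> len u = len v ->
    gp (a u^-1%g o) z z' <= C + 2 * delta.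
  move=> uv lu; rewrite -(gp_act a u) actKV.
  apply: (gp_move_le hyp delta_gt0 hk).
    by apply: lt_le_trans (gp_ge _ _ _); rewrite zo vz// lu; lra.
  by apply: lt_le_trans (gp_ge _ _ _); rewrite z'o vz'// lu; lra.
have near1 := near v (commute_refl v) erefl.
have := near v^-1%g cv (lenV a o v); rewrite invgK => near2.
have near0 : gp o z z' <= C + 2 * delta by lra.
have l1 := line_dist hyp near1 near0.
have l2 := line_dist hyp near0 near2.
have l3 := line_dist hyp near1 near2.
have d1 : mdist (a v^-1%g o) o = len v by rewrite -(lenV a o v).
have d2 : mdist o (a v o) = len v by rewrite metric_sym.
have d3 : mdist (a v^-1%g o) (a v o) = len (v ^+ 2)%g.
  by rewrite metric_sym len_dist invgK expg2.
rewrite d1 in l1; rewrite d2 in l2; rewrite d3 in l3.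
have t1 := metric_triangle (a v^-1%g o) o z.
have t2 := metric_triangle o (a v^-1%g o) z.
have t3 := metric_triangle o (a v o) z.
have t4 := metric_triangle (a v o) o z.
have t5 := metric_triangle (a v^-1%g o) (a v o) z.
have t6 := metric_triangle (a v o) (a v^-1%g o) z.
rewrite ?(metric_sym o (a v^-1%g o)) ?(metric_sym (a v o) o) ?d1 ?d2 in t1 t2 t3 t4.
rewrite ?(metric_sym (a v o) (a v^-1%g o)) d3 in t5 t6.
have tv := tl_le_len a o v.
have tv2 := tl_le a o v 2.
have kE := gp_expg a o v 1 1; rewrite !expg1 in kE.
have kle : gp o (a v^-1%g o) (a v o) <= 2 * C + 6 * delta.
  rewrite kE addn1; set x := mdist (a v^-1%g o) z in l1 l3 t1 t2 t5 t6.
  set y := mdist o z in l1 l2 t1 t2 t3 t4; set t := mdist (a v o) z in l2 l3 t3 t4 t5 t6.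
  case: (ler0P (x - y)) l1 => ?; case: (ler0P (y - t)) l2 => ?;
  case: (ler0P (x - t)) l3 => ? *; lra.
rewrite (_ : 2 * C + 8 * delta = 2 * C + 6 * delta + 2 * delta); last by lra.
by apply: quasi_axisP => //; lra.
Qed.

(** An element v that has a power in common with w translates along the axis of w
    by its translation length. The error does not depend on the exponents n
    and j, because the position of v p is compared with that of p directly,
    through the quasi-axis of v. *)
Lemma axis_shift w v n j (C c : R) p q (t u : R) :
  0 <= C -> (forall m, gp o (a (w^-1 ^+ m)%g o) (a (w ^+ m)%g o) <= C) ->
  (0 < n)%N -> (0 < j)%N -> (v ^+ n = w ^+ j)%g ->
  4 * C + 15 * delta < tl v ->
  0 <= c -> on_axis a o w c p t -> on_axis a o w c q u ->
  `|mdist (a v p) q - `|t + tl v - u| | <= 4 * c + 4 * C + 24 * delta.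
Proof.
have dg := delta_gt0.
move=> C0 wC n0 j0 vw v_long c0 hp hq; have v0 : 0 < tl v by lra.
have vwX m : (v ^+ (n * m) = w ^+ (j * m))%g by rewrite !expgnA vw.
have vwXV m : (v^-1 ^+ (n * m) = w^-1 ^+ (j * m))%g by rewrite !expVgn vwX.
have ax : quasi_axis a o (2 * C + 8 * delta) v.
  apply: root_axis => // k; exists (n * k)%N; split; first exact: leq_pmull.
  by rewrite vwX vwXV.
have [m0 hm0] := tl_unbounded
  (c + 4 * delta + 3 * len v + 3 * mdist p o) v0.
pose m := m0.+1.
have lm := hm0 (n * m)%N (leq_trans (leqnSn _) (leq_pmull _ n0)).
have jm0 : (0 < j * m)%N by rewrite muln_gt0 j0.
have [p1 p2] := hp _ jm0; have [q1 q2] := hq _ jm0.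
move: p1 p2 q1 q2; rewrite -vwX -vwXV.
set z := a (v^-1 ^+ (n * m))%g o; set z' := a (v ^+ (n * m))%g o.
move=> p1 p2 q1 q2.
have zo : mdist z o = len (v ^+ (n * m))%g by rewrite -len_expV.
have z'o : mdist z' o = len (v ^+ (n * m))%g by [].
have cv : commute v^-1%g v by apply: commute_sym; apply: commuteV.
have vz : mdist z (a v^-1%g z) = len v.
  by rewrite /z actXC act_isom (metric_sym o) -(lenV a o v).
have vz' : mdist z' (a v^-1%g z') = len v.
  rewrite /z' act_commute; last exact: commuteX.
  by rewrite act_isom (metric_sym o) -(lenV a o v).
have lv := len_ge0 a o v; have po := mdist_ge0 p o.
have t1 := metric_triangle z p o; have t2 := metric_triangle z' p o.
(* The distant points z and z' are moved by v only by the length of v, hence p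
   sees them and their images in almost the same directions. *)
have vp1 : gp (a v p) z z' <= c + 2 * delta.
  rewrite -(gp_act a v^-1%g) actK.
  apply: (gp_move_le hyp delta_gt0 p1).
    by apply: lt_le_trans (gp_ge _ _ _); rewrite vz; lra.
  by apply: lt_le_trans (gp_ge _ _ _); rewrite vz'; lra.
(* Seen from the distant points z and z1, the differences of distances to p and
   to o almost agree, so that it suffices to know how v moves o. *)
set z1 := a v^-1%g z in vz.
have vpz : mdist (a v p) z = mdist p z1 by rewrite -(act_isom a v p) actKV.
have oz1 : mdist o z1 = len (v ^+ (n * m + 1))%g.
  rewrite metric_sym /z1 /z -actM -expgS -/(displacement _ _ _) addn1.
  by rewrite -/(len _) len_expV.
have t3 := metric_triangle z1 p o; have t4 := metric_triangle z z1 o.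
have t5 := metric_triangle z1 o p; have t6 := metric_triangle o p z.
have f1 := four_point hyp p o z1 z.
have f2 := four_point hyp o p z1 z.
have kE := gp_expg a o v (n * m) 1; have := ax (n * m)%N 1%N.
rewrite kE -oz1 !expg1 => kle.
have lsub : mdist o z1 <= len (v ^+ (n * m))%g + len v.
  by rewrite oz1 -{2}(expg1 v) len_exp_sub.
have dv : len v <= tl v + 2 * (2 * C + 8 * delta).
  by have := quasi_axis_len 1 ax; rewrite mul1r expg1.
have tv := tl_le_len a o v.
rewrite (metric_sym z1 z) vz (metric_sym o z) zo (metric_sym o p) in f1 f2.
rewrite (metric_sym z p) zo in t1 t2.
rewrite zo vz (metric_sym z1 o) in t4.
rewrite (metric_sym z1 p) (metric_sym z1 o) in t3 t5.
have pos : `|mdist p z1 - mdist p z - tl v| <= 2 * delta + 2 * (2 * C + 8 * delta).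
  have {}f1 : mdist p z1 - mdist p z <= mdist o z1 - len (v ^+ (n * m))%g + 2 * delta.
    by rewrite -lerBlDr le_max in f1; case/orP: f1 => f1; lra.
  have {}f2 : mdist o z1 - len (v ^+ (n * m))%g <= mdist p z1 - mdist p z + 2 * delta.
    by rewrite -lerBlDr le_max in f2; case/orP: f2 => f2; lra.
  by rewrite ler_norml; apply/andP; split; lra.
have l : mdist (a v p) q <= `|mdist (a v p) z - mdist q z| + 2 * (c + 2 * delta) + 2 * delta.
  by apply: (line_dist hyp vp1) => //; lra.
have s1 := metric_triangle (a v p) q z; have s2 := metric_triangle q (a v p) z.
rewrite (metric_sym q (a v p)) in s2.
have l' : `|mdist (a v p) z - mdist q z| <= mdist (a v p) q.
  by rewrite ler_norml; apply/andP; split; lra.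
rewrite vpz in l l'.
have e : `|(mdist p z1 - mdist q z) - (t + tl v - u)| <=
    2 * c + 2 * delta + 2 * (2 * C + 8 * delta).
  move: p2 q2 pos; rewrite !ler_norml => /andP[? ?] /andP[? ?] /andP[? ?].
  by apply/andP; split; lra.
have e' := le_trans (ler_dist_dist _ _) e.
by move: e'; rewrite !ler_norml => /andP[? ?]; apply/andP; split; lra.
Qed.

End Roots.


(** * Powers of two independent loxodromics *)

Section IndependentPair.
Context {R : realType} {G : groupType} {X : metricType R}.
Variables (a : isometric_action G X) (o : X) (delta : R).
Hypothesis hyp : delta_hyperbolic (X := X) delta.
Hypothesis delta_gt0 : 0 < delta.
Implicit Types (g h v w : G) (n m i j k l : nat) (p q z : X).
Local Notation len := (displacement a o).
Local Notation tl := (translation_length a o).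

Definition orient (b : bool) g := if b then g else g^-1%g.

Definition independent (K : R) g h := forall b b' i j,
  gp o (a (orient b g ^+ i)%g o) (a (orient b' h ^+ j) o)%g <= K.

Variables (g h : G) (K : R).
Hypothesis K_ge0 : 0 <= K.
Hypothesis gP : 0 < tl g.
Hypothesis hP : 0 < tl h.
Hypothesis axg : quasi_axis a o K g.
Hypothesis axh : quasi_axis a o K h.
Hypothesis indep : independent K g h.
Variables (N M : nat).
Hypothesis longN : 2 * K + 3 * delta < N%:R * tl g.
Hypothesis longM : 2 * K + 3 * delta < M%:R * tl h.
Local Notation w := (g ^+ N * h ^+ M)%g.

Let turn1 : gp o (a (g ^+ N)^-1%g o) (a (h ^+ M)%g o) <= K.
Proof. by have := indep false true N M; rewrite /orient expVgn. Qed.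

Let turn2 : gp o (a (h ^+ M)^-1%g o) (a (g ^+ N)%g o) <= K.
Proof. by have := indep true false N M; rewrite /orient expVgn gpC. Qed.

Let long1 : 2 * K + 3 * delta < len (g ^+ N)%g.
Proof. by apply: lt_le_trans longN _; exact: tl_le. Qed.

Let long2 : 2 * K + 3 * delta < len (h ^+ M)%g.
Proof. by apply: lt_le_trans longM _; exact: tl_le. Qed.

Lemma product_tl_lower :
  N%:R * tl g + M%:R * tl h - 4 * (K + 2 * delta) <= tl w.
Proof.
have := two_blocks_tl hyp delta_gt0 K_ge0 turn1 turn2 long1 long2.
have := tl_le a o g N; have := tl_le a o h M; lra.
Qed.

Lemma product_tl_upper : tl w <= N%:R * tl g + M%:R * tl h + 4 * K.
Proof.
have := tl_le_len a o w; have := lenM a o (g ^+ N)%g (h ^+ M)%g.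
have := quasi_axis_len N axg; have := quasi_axis_len M axh; lra.
Qed.

Let between (u : G) n i : quasi_axis a o K u -> (i <= n)%N ->
  gp (a (u ^+ i)%g o) o (a (u ^+ n)%g o) <= K.
Proof.
move=> ax /subnKC <-; rewrite -(gp_act a (u ^+ i)^-1%g) actK.
by rewrite -expVgn expgnDr -!actM expVgn mulKg -expVgn.
Qed.

Let c := 2 * K + 6 * (K + 2 * delta).

Let c_ge0 : 0 <= c.
Proof. by have := K_ge0; have := delta_gt0; rewrite /c; lra. Qed.

Let D := 4 * c + 4 * (3 * (K + 2 * delta)) + 24 * delta + 4 * K.

(** [axis_shift] for w = g^N h^M, at points of the first block g^N and of the second
    block h^M, with an error that does not depend on N, M and v. *)
Lemma product_root_shift v n j i :
  (0 < n)%N -> (0 < j)%N -> (v ^+ n = w ^+ j)%g ->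
  12 * (K + 2 * delta) + 15 * delta < tl v -> (i <= N)%N ->
  (forall k, (k <= N)%N ->
     mdist (a v (a (g ^+ i)%g o)) (a (g ^+ k)%g o)
       <= `|i%:R * tl g + tl v - k%:R * tl g| + D + 2 * K) /\
  (forall l, (l <= M)%N ->
     mdist (a v (a (g ^+ i)%g o)) (a (g ^+ N)%g (a (h ^+ l)%g o))
       <= `|i%:R * tl g + tl v - (N%:R * tl g + l%:R * tl h)| + D + 2 * K).
Proof.
have Kg := K_ge0; have dg := delta_gt0.
move=> n0 j0 vw v_long iN.
have ends := on_axis_ends hyp delta_gt0 K_ge0 turn1 turn2 long1 long2.
have C0 : 0 <= 3 * (K + 2 * delta) by lra.
have vl : 4 * (3 * (K + 2 * delta)) + 15 * delta < tl v by lra.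
have first k : (k <= N)%N ->
    on_axis a o w c (a (g ^+ k)%g o) (len (g ^+ k)%g).
  move=> kN; apply: (on_axis_first hyp delta_gt0 K_ge0 turn1 turn2 long1 long2) => //.
  exact: between.
have second l : (l <= M)%N ->
    on_axis a o w c (a (g ^+ N)%g (a (h ^+ l)%g o)) (len (g ^+ N)%g + len (h ^+ l)%g).
  move=> lM; apply: (on_axis_second hyp delta_gt0 K_ge0 turn1 turn2 long1 long2) => //.
  exact: between.
have shift := axis_shift hyp delta_gt0 C0 ends n0 j0 vw vl c_ge0 (first _ iN).
have est u k : quasi_axis a o K u -> k%:R * tl u <= len (u ^+ k)%g <= k%:R * tl u + 2 * K.
  by move=> ax; rewrite tl_le (quasi_axis_len k ax).
have /andP[gi1 gi2] := est g i axg; have /andP[gN1 gN2] := est g N axg.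
have step (x y y' d e : R) : `|d - `|x| | <= e -> `|x - y| <= y' -> d <= `|y| + e + y'.
  move=> h1 h2; have := le_trans (ler_dist_dist x y) h2.
  by move: h1; rewrite !ler_norml => /andP[? ?] /andP[? ?]; lra.
split=> [k kN|l lM].
  have /andP[gk1 gk2] := est g k axg.
  have := step _ (i%:R * tl g + tl v - k%:R * tl g) (6 * K) _ _ (shift _ _ (first _ kN)).
  by rewrite /D => H; apply: le_trans (H _) _; [rewrite ler_norml; apply/andP; split|]; lra.
have /andP[hl1 hl2] := est h l axh.
have := step _ (i%:R * tl g + tl v - (N%:R * tl g + l%:R * tl h)) (6 * K) _ _ (shift _ _ (second _ lM)).
by rewrite /D => H; apply: le_trans (H _) _; [rewrite ler_norml; apply/andP; split|]; lra.
Qed.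

End IndependentPair.


(** * Products with an isometry of small displacement *)

Section ThreeBlocks.
Context {R : realType} {G : groupType} {X : metricType R}.
Variables (a : isometric_action G X) (o : X) (delta : R).
Hypothesis hyp : delta_hyperbolic (X := X) delta.
Hypothesis delta_gt0 : 0 < delta.
Implicit Types (g h r s t w : G).
Local Notation len := (displacement a o).
Local Notation tl := (translation_length a o).

Lemma tl_gt0_turn w kappa : 0 <= kappa ->
  gp o (a w^-1%g o) (a w o) <= kappa -> 2 * kappa + 4 * delta < len w ->
  0 < tl w.
Proof.
have dg := delta_gt0 => k0 hk hl.
have ax : quasi_axis a o (kappa + 2 * delta) w by apply: quasi_axisP => //; lra.
by have := quasi_axis_len 1 ax; rewrite expg1 mul1r; lra.
Qed.

Lemma gp_prefix r t :
  gp o (a r o) (a (r * t)%g o) = len r - gp o (a r^-1%g o) (a t o).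
Proof.
rewrite gp_swap metric_sym; congr (_ - _).
by rewrite actM -(gp_act a r^-1%g) !actK.
Qed.

Lemma len_mul r t :
  len (r * t)%g = len r + len t - 2 * gp o (a r^-1%g o) (a t o).
Proof.
rewrite /gp -/(displacement a o _) -/(displacement a o _) lenV.
by rewrite metric_sym len_dist invgK; lra.
Qed.

(** The product rs fails to be loxodromic only if s^(-1) almost maps the direction of
    r^(-1) o to that of r o, and rts only if s^(-1) almost maps the direction of
    t^(-1) o to that of r o. The directions of r^(-1) o and t^(-1) o differ,
    and s moves o only a little, so that both cannot happen at once. *)
Lemma one_of_two_lox r t s K : 0 <= K ->
  gp o (a r^-1%g o) (a t^-1%g o) <= K -> gp o (a r^-1%g o) (a t o) <= K ->
  5 * K + 5 * len s + 12 * delta < len r ->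
  5 * K + 5 * len s + 12 * delta < len t ->
  0 < tl (r * s)%g \/ 0 < tl (r * t * s)%g.
Proof.
have dg := delta_gt0; have ls := len_ge0 a o s.
move=> K0 rt rt' long_r long_t.
have sV (p q : X) : gp o (a s^-1%g p) (a s^-1%g q) = gp (a s o) p q.
  by rewrite -(gp_act a s) !actKV.
have alt : Num.min (gp o (a s^-1%g (a r^-1%g o)) (a r o))
    (gp o (a r o) (a s^-1%g (a t^-1%g o))) <= K + len s + delta.
  rewrite -lerBlDr; apply: le_trans (hyp _ _ _ _) _; rewrite sV.
  by apply: le_trans (gp_base _ o _ _) _; rewrite lerD2r.
rewrite ge_min in alt; case/orP: alt => alt; [left|right].
  apply: (@tl_gt0_turn _ (K + 2 * len s + delta)); first by lra.
    rewrite invgM !actM gpC; apply: le_trans (gp_point _ _ (a r o) _) _.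
    by rewrite gpC act_isom -/(displacement a o s); lra.
  by have := lenM a o (r * s)%g s^-1%g; rewrite mulgK lenV; lra.
have big_r : len r - K - len s <= gp o (a r o) (a (r * t * s)%g o).
  rewrite -mulgA gp_prefix.
  have : gp o (a r^-1%g o) (a (t * s)%g o) <= K + len s.
    rewrite gpC; apply: le_trans (gp_point _ _ (a t o) _) _.
    by rewrite gpC actM act_isom -/(displacement a o s) lerD2r.
  by lra.
have big_t : len t - K - len s <=
    gp o (a s^-1%g (a t^-1%g o)) (a (r * t * s)^-1%g o).
  rewrite !invgM !actM sV -(actM a t^-1%g).
  have := gp_base o (a s o) (a t^-1%g o) (a (t^-1 * r^-1)%g o).
  rewrite gp_prefix lenV invgK gpC (metric_sym o) -/(displacement a o s) => H.
  lra.
apply: (@tl_gt0_turn _ (K + len s + 3 * delta)); first by lra.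
  rewrite (_ : K + len s + 3 * delta = K + len s + delta + 2 * delta); last by lra.
  rewrite gpC in alt.
  by apply: (gp_move_le hyp delta_gt0 alt); lra.
have := gp_le o (a (r * t * s)%g o) (a r o); rewrite gpC.
rewrite -/(displacement a o _); lra.
Qed.

Lemma three_blocks_tl r t s K : 0 <= K ->
  gp o (a r^-1%g o) (a t o) <= K -> gp o (a t^-1%g o) (a s o) <= K ->
  gp o (a s^-1%g o) (a r o) <= K ->
  4 * K + 5 * delta < len r -> 4 * K + 5 * delta < len t ->
  4 * K + 5 * delta < len s ->
  len r + len t + len s - 6 * K - 12 * delta <= tl (r * t * s)%g.
Proof.
have dg := delta_gt0.
move=> K0 rt ts sr lr lt' ls.
have lrt := len_mul r t.
have := @two_blocks_tl R G X a o delta hyp dg (r * t)%g s (K + delta).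
have turn1 : gp o (a (r * t)^-1%g o) (a s o) <= K + delta.
  rewrite gpC; rewrite gpC; apply: (gp_trans_le hyp ts).
  by rewrite invgM gp_prefix lenV invgK gpC; lra.
have turn2 : gp o (a s^-1%g o) (a (r * t)%g o) <= K + delta.
  rewrite gpC; rewrite gpC in sr; apply: (gp_trans_le hyp sr).
  by rewrite gp_prefix; lra.
move=> /(_ _ turn1 turn2) H.
suff : len (r * t)%g + len s - 4 * (K + delta + 2 * delta) <= tl (r * t * s)%g by lra.
by apply: H; lra.
Qed.

End ThreeBlocks.


(** * The boundary and its topology *)

Section GromovSequences.
Context {R : realType} {X : metricType R}.
Variables (o : X) (delta : R).
Hypothesis hyp : delta_hyperbolic (X := X) delta.
Hypothesis delta_gt0 : 0 < delta.
Implicit Types (x y z : nat -> X) (xi eta zeta : boundary o) (T C : R).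

Definition eventually_far x y T :=
  exists n0, forall i j, (n0 <= i)%N -> (n0 <= j)%N -> T <= gp o (x i) (y j).

Lemma asymptoticP x y : asymptotic o x y <-> forall T, eventually_far x y T.
Proof.
rewrite /asymptotic; split=> [/cvgryPge H T|H].
  have [[P Q] [[/= n1 _ h1] [n2 _ h2]] h] := H T.
  exists (maxn n1 n2) => i j; rewrite !geq_max => /andP[i1 _] /andP[_ j2].
  by apply: (h (i, j)); split=> /=; [apply: h1|apply: h2].
apply/cvgryPge => T; have [n0 h] := H T.
exists ([set i | (n0 <= i)%N], [set j | (n0 <= j)%N]).
  by split; exists n0.
by move=> [i j] /= [hi hj]; exact: h.
Qed.

Lemma asymptotic_sym x y : asymptotic o x y -> asymptotic o y x.
Proof.
move=> /asymptoticP h; apply/asymptoticP => T; have [n0 H] := h T.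
by exists n0 => i j hi hj; rewrite gpC; exact: H.
Qed.

Lemma eventually_far_trans x y z T : eventually_far x y T ->
  eventually_far y z T -> eventually_far x z (T - delta).
Proof.
move=> [n1 h1] [n2 h2]; exists (maxn n1 n2) => i j.
rewrite !geq_max => /andP[i1 i2] /andP[j1 j2].
apply: (gp_trans_ge hyp) (h1 _ (maxn n1 n2) i1 _) (h2 (maxn n1 n2) _ _ j2).
  exact: leq_maxl.
exact: leq_maxr.
Qed.

Lemma eventually_far_le x y T T' : T' <= T ->
  eventually_far x y T -> eventually_far x y T'.
Proof.
by move=> TT [n0 h]; exists n0 => i j hi hj; apply: le_trans TT (h _ _ hi hj).
Qed.

Lemma asymptotic_trans x y z :
  asymptotic o x y -> asymptotic o y z -> asymptotic o x z.
Proof.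
move=> /asymptoticP xy /asymptoticP yz; apply/asymptoticP => T.
rewrite -(addrK delta T).
by apply: eventually_far_trans (xy _) (yz _).
Qed.

(** Two Gromov sequences either converge to the same point or have Gromov products
    bounded along their tails. *)
Lemma bounded_of_not_asymptotic x y : gromov_seq o x -> gromov_seq o y ->
  ~ asymptotic o x y ->
  exists C n0, forall i j, (n0 <= i)%N -> (n0 <= j)%N -> gp o (x i) (y j) <= C.
Proof.
have dg := delta_gt0; move=> /asymptoticP xx /asymptoticP yy nxy.
have [T nT] : exists T, ~ eventually_far x y T.
  by apply: contrapT => /forallNP h; apply/nxy/asymptoticP => T; exact: contrapT (h _).
have [n1 h1] := xx (T + 3 * delta); have [n2 h2] := yy (T + 3 * delta).
exists (T + 2 * delta), (maxn n1 n2) => i j.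
rewrite !geq_max => /andP[i1 i2] /andP[j1 j2].
rewrite leNgt; apply/negP => lt; apply: nT; exists (maxn n1 n2) => i' j'.
rewrite !geq_max => /andP[i1' i2'] /andP[j1' j2'].
have a1 : T + 2 * delta <= gp o (x i') (x i) by apply: le_trans (h1 _ _ i1' i1); lra.
have a2 : T + delta <= gp o (x i') (y j).
  have := gp_trans_ge hyp a1 (ltW lt); lra.
have a3 : T + delta <= gp o (y j) (y j') by apply: le_trans (h2 _ _ j2 j2'); lra.
have := gp_trans_ge hyp a2 a3; lra.
Qed.

Lemma asymptotic_near x y C : gromov_seq o x ->
  (forall n, mdist (x n) (y n) <= C) -> gromov_seq o y /\ asymptotic o x y.
Proof.
move=> /asymptoticP xx hC; split; apply/asymptoticP => T.
  have [n0 h] := xx (T + C + C); exists n0 => i j hi hj.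
  have := h _ _ hi hj; have := gp_point o (x i) (y i) (x j).
  have := gp_point o (x j) (y j) (y i); rewrite (gpC o (x j) (y i)) (gpC o (y j)).
  have := hC i; have := hC j; lra.
have [n0 h] := xx (T + C); exists n0 => i j hi hj.
have := h _ _ hi hj; have := gp_point o (x j) (y j) (x i).
rewrite (gpC _ _ (x i)) (gpC _ _ (x i)); have := hC j; lra.
Qed.

Lemma bseqs_nonempty xi : exists x, boundary_seqs xi x.
Proof. by have [x xx ->] := boundary_seqsP xi; exists x. Qed.

Lemma bseqs_of x : gromov_seq o x -> exists xi, boundary_seqs xi x.
Proof.
move=> xx; have h : exists2 x', gromov_seq o x' &
    asymptotic_class o x = asymptotic_class o x' by exists x.
by exists (Boundary h).
Qed.

Lemma bseqs_gromov xi x : boundary_seqs xi x -> gromov_seq o x.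
Proof. by have [x' xx ->] := boundary_seqsP xi => -[]. Qed.

Lemma bseqs_asymptotic xi x y :
  boundary_seqs xi x -> boundary_seqs xi y -> asymptotic o x y.
Proof.
have [x' xx ->] := boundary_seqsP xi => -[_ h1] [_ h2].
exact: asymptotic_trans (asymptotic_sym h1) h2.
Qed.

Lemma bseqs_closed xi x y : boundary_seqs xi x -> gromov_seq o y ->
  asymptotic o x y -> boundary_seqs xi y.
Proof.
have [x' xx ->] := boundary_seqsP xi => -[_ h1] gy xy.
by split=> //; exact: asymptotic_trans xy.
Qed.

Lemma bseqs_eq xi eta x y : boundary_seqs xi x -> boundary_seqs eta y ->
  asymptotic o x y -> xi = eta.
Proof.
move=> xix etay xy; apply: boundary_eq; apply/seteqP; split=> z hz.
  apply: (bseqs_closed etay); first exact: bseqs_gromov hz.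
  by apply: asymptotic_trans (asymptotic_sym xy) _; apply: bseqs_asymptotic xix hz.
apply: (bseqs_closed xix); first exact: bseqs_gromov hz.
by apply: asymptotic_trans xy _; apply: bseqs_asymptotic etay hz.
Qed.

(** This says that the Gromov product of two boundary points is at least T, up to
    2 delta, in terms of a single pair of sequences. It avoids the limits and
    infima in [ext_gromov_product]. *)
Definition close_points xi eta T :=
  exists x y, [/\ boundary_seqs xi x, boundary_seqs eta y & eventually_far x y T].

Lemma close_points_seqs xi eta x y T : boundary_seqs xi x ->
  boundary_seqs eta y -> close_points xi eta T ->
  eventually_far x y (T - 2 * delta).
Proof.
have dg := delta_gt0; move=> hx hy [x' [y' [hx' hy' far]]].
have /asymptoticP/(_ T) xx := bseqs_asymptotic hx hx'.
have /asymptoticP/(_ (T - delta)) yy := bseqs_asymptotic hy' hy.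
have := eventually_far_trans (eventually_far_trans xx far) yy.
by apply: eventually_far_le; lra.
Qed.

Lemma close_points_sym xi eta T : close_points xi eta T -> close_points eta xi T.
Proof.
move=> [x [y [hx hy [n0 h]]]]; exists y, x; split=> //; exists n0 => i j hi hj.
by rewrite gpC; exact: h.
Qed.

Lemma close_points_trans xi eta zeta T : close_points xi eta T ->
  close_points eta zeta T -> close_points xi zeta (T - 3 * delta).
Proof.
have dg := delta_gt0; move=> [x [y [hx hy far]]] c2.
have [z hz] := bseqs_nonempty zeta.
exists x, z; split=> //.
have := close_points_seqs hy hz c2 => far2.
have far' : eventually_far x y (T - 2 * delta) by apply: eventually_far_le far; lra.
have := eventually_far_trans far' far2; apply: eventually_far_le; lra.
Qed.

Lemma close_points_eq xi eta : (forall T, close_points xi eta T) -> xi = eta.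
Proof.
move=> h; have [x hx] := bseqs_nonempty xi; have [y hy] := bseqs_nonempty eta.
apply: (bseqs_eq hx hy); apply/asymptoticP => T.
by rewrite -(addrK (2 * delta) T); apply: close_points_seqs (h _).
Qed.

Local Notation ext z w := (ext_gromov_product (o := o) z w).

Lemma ext_gp_ge xi eta T : close_points xi eta T ->
  ((T - 2 * delta)%:E <= ext (AtInfinity xi) (AtInfinity eta))%E.
Proof.
move=> h; apply: le_ereal_inf_tmp => _ [[x y] [/= hx hy] <-].
have [n0 far] := close_points_seqs hx hy h.
rewrite limf_einfE; apply: le_ereal_sup_tmp.
exists (ereal_inf [set (gp o (x ij.1) (y ij.2))%:E | ij in
    [set i | (n0 <= i)%N] `*` [set j | (n0 <= j)%N]]).
  exists ([set i | (n0 <= i)%N] `*` [set j | (n0 <= j)%N]) => //.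
  exists ([set i | (n0 <= i)%N], [set j | (n0 <= j)%N]) => //.
  by split; exists n0.
apply: le_ereal_inf_tmp => _ [[i j] [/= hi hj] <-].
by rewrite lee_fin; exact: far.
Qed.

Lemma ext_gp_gt xi eta T :
  (T%:E < ext (AtInfinity xi) (AtInfinity eta))%E -> close_points xi eta T.
Proof.
move=> h; have [x hx] := bseqs_nonempty xi; have [y hy] := bseqs_nonempty eta.
exists x, y; split=> //.
have {h} : (T%:E < limf_einf (fun ij => (gp o (x ij.1) (y ij.2))%:E)
     (filter_prod \oo \oo))%E.
  by apply: lt_le_trans h _; apply: ereal_inf_lbound; exists (x, y).
rewrite limf_einfE => /ereal_sup_gt[_ [V FV <-] hV].
have [[P Q] [[/= n1 _ h1] [n2 _ h2]] PQ] := FV.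
exists (maxn n1 n2) => i j; rewrite !geq_max => /andP[i1 _] /andP[_ j2].
have Vij : V (i, j) by apply: PQ; split=> /=; [apply: h1|apply: h2].
rewrite -lee_fin; apply: (le_trans (ltW hV)).
by apply: ereal_inf_lbound; exists (i, j).
Qed.

Lemma nbhs_boundary xi (U : set (boundary o)) : nbhs xi U ->
  exists T, forall eta, close_points eta xi T -> U eta.
Proof.
rewrite nbhsE => -[B [[W oW <-] Wxi] BU].
have [t ht] := oW.2 xi Wxi.
exists (t + 3 * delta) => eta h; apply: BU; apply: ht; rewrite /bord_ball /=.
apply: lt_le_trans (ext_gp_ge h).
by rewrite lte_fin; have := delta_gt0; lra.
Qed.

(** If z m converges to zeta and xi <> zeta, a neighbourhood of xi avoids a tail of
    the z m. The complement of the tail and of zeta is open by definition of the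
    topology: a point outside has bounded Gromov products with zeta, hence with
    all but finitely many z m, and with each of the remaining ones. *)
Lemma boundary_separation (z : nat -> boundary o) zeta xi :
  (forall T, exists m0, forall m, (m0 <= m)%N -> close_points (z m) zeta T) ->
  xi <> zeta ->
  exists2 U, nbhs xi U & exists m0, forall m, (m0 <= m)%N -> ~ U (z m).
Proof.
move=> hz xizeta.
have sep eta : eta <> zeta -> exists T, ~ close_points eta zeta T.
  by move=> ne; apply: contrapT => /forallNP h; apply/ne/close_points_eq => T; exact: contrapT (h _).
have avoid eta : eta <> zeta ->
    exists T m0, forall m, (m0 <= m)%N -> ~ close_points (z m) eta T.
  move=> /sep[T nT]; have [m0 h] := hz (T + 3 * delta).
  exists (T + 3 * delta), m0 => m /h c1 c2; apply: nT.
  rewrite -(addrK (3 * delta) T).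
  exact: close_points_trans (close_points_sym c2) c1.
have [T0 [m0 h0]] := avoid _ xizeta.
pose W := [set w : bordification o | match w with
  | Inside _ => True
  | AtInfinity eta => eta <> zeta /\ forall m, (m0 <= m)%N -> eta <> z m end].
have oW : open W.
  split; first by rewrite (_ : [set _ | _] = setT) //; exact: openT.
  move=> eta [ez em]; have [T [m1 h1]] := avoid _ ez.
  have [T1 hT1] := sep _ ez.
  have [T' hT'] : exists T', forall m, (m0 <= m)%N -> (m < m1)%N -> ~ close_points (z m) eta T'.
    elim: m1 {h1} => [|m1 [T' IH]]; first by exists 0.
    case: (leqP m0 m1) => m01; last first.
      by exists T' => m mm; rewrite ltnS => mm1; move: (leq_ltn_trans mm (leq_ltn_trans mm1 m01)); rewrite ltnn.
    have [T'' hT''] : exists T, ~ close_points (z m1) eta T.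
      apply: contrapT => /forallNP h; apply: (em m1 m01); apply/esym.
      by apply: close_points_eq => T''; exact: contrapT (h _).
    exists (Num.max T' T'') => m mm; rewrite ltnS leq_eqVlt => /orP[/eqP ->|mm1] [x [y [hx hy far]]].
      by apply: hT''; exists x, y; split=> //; apply: eventually_far_le far; rewrite le_max lexx orbT.
    by apply: (IH m mm mm1); exists x, y; split=> //; apply: eventually_far_le far; rewrite le_max lexx.
  exists (Num.max T1 (Num.max T T')) => -[p //|eta'] /ext_gp_gt far; split=> [E|m mm E]; subst.
    apply: hT1; apply: close_points_sym.
    have [x [y [hx hy h]]] := far; exists x, y; split=> //.
    by apply: eventually_far_le h; rewrite le_max lexx.
  have [x [y [hx hy h]]] := far.
  case: (ltnP m m1) => mm1; [apply: (hT' m mm mm1)|apply: (h1 m mm1)];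
    by exists x, y; split=> //; apply: eventually_far_le h; rewrite !le_max lexx ?orbT.
exists ((@AtInfinity R X o) @^-1` W).
  rewrite nbhsE; exists (@AtInfinity R X o @^-1` W) => //; split; first by exists W.
  split=> // m mm E; subst xi.
  have : close_points (z m) (z m) T0.
    have [x hx] := bseqs_nonempty (z m); exists x, x; split=> //.
    by have /asymptoticP := bseqs_asymptotic hx hx; apply.
  exact: h0.
by exists m0 => m mm [_ /(_ m mm)].
Qed.

End GromovSequences.


(** * The action on the boundary *)

Section Separation.
Context {G : groupType} {T : eqType} (f : G -> T -> T).
Hypothesis f1 : forall x, f 1%g x = x.
Hypothesis fM : forall g h x, f (g * h)%g x = f g (f h x).
Hypothesis infinite_orbits : forall (B : seq T) x, exists g, f g x \notin B.

(** Theorem of Birch, Burns, Macdonald and Neumann. Since orbits are infinite,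
    there is a finite set F none of whose translates F z lies in B. By induction some
    g moves the points of A other than y off all the translates t^(-1) B with t
    in F. An element t of F that sends g y off B completes the proof, with t g. *)
Lemma separate_finite_sets (A B : seq T) :
  exists g, forall x, x \in A -> f g x \notin B.
Proof.
elim: A B => [|y A IH] B; first by exists 1%g.
have [F hF] : exists F : seq G, forall z, exists2 t, t \in F & f t z \notin B.
  have [F hF] : exists F : seq G, forall z, z \in B ->
      exists2 t, t \in F & f t z \notin B.
    suff h (C : seq T) : exists F : seq G, forall z, z \in C ->
        exists2 t, t \in F & f t z \notin B by exact: h.
    elim: C => [|z C [F hF]]; first by exists [::].
    have [t ht] := infinite_orbits B z; exists (t :: F) => u.
    rewrite inE => /orP[/eqP ->|/hF[t' t'F h]]; first by exists t; rewrite ?mem_head.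
    by exists t' => //; rewrite inE t'F orbT.
  exists (1%g :: F) => z; case: (boolP (z \in B)) => [/hF[t tF h]|zB].
    by exists t => //; rewrite inE tF orbT.
  by exists 1%g; rewrite ?mem_head// f1.
have [g hg] := IH [seq f t^-1%g b | t <- F, b <- B].
have [t tF ht] := hF (f g y).
exists (t * g)%g => x; rewrite inE fM => /orP[/eqP -> //|xA].
apply: contra (hg x xA) => tgx; apply/allpairsP.
by exists (t, f t (f g x)); split => //=; rewrite -fM mulVg f1.
Qed.

End Separation.

Section BoundaryAction.
Context {R : realType} {G : groupType} {X : metricType R}.
Variables (a : isometric_action G X) (o : X) (delta : R).
Hypothesis hyp : delta_hyperbolic (X := X) delta.
Hypothesis delta_gt0 : 0 < delta.
Implicit Types (g h t u : G) (xi eta : boundary o) (x y : nat -> X).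
Local Notation len := (displacement a o).
Local Notation tl := (translation_length a o).

Definition ray g n : X := a (g ^+ n)%g o.

Lemma boundary_act_seqs g xi x :
  boundary_seqs xi x -> boundary_seqs (boundary_act a g xi) (a g \o x).
Proof. by move=> h; exists x. Qed.

Lemma boundary_actM g h xi :
  boundary_act a (g * h)%g xi = boundary_act a g (boundary_act a h xi).
Proof.
have [x hx] := bseqs_nonempty xi.
have h1 := boundary_act_seqs (g * h)%g hx.
have h2 := boundary_act_seqs g (boundary_act_seqs h hx).
apply: (bseqs_eq hyp h1 h2).
rewrite (_ : a (g * h)%g \o x = a g \o (a h \o x)) in h1 *.
  exact: bseqs_gromov h2.
by apply/funext => n /=; rewrite actM.
Qed.

Lemma boundary_act1 xi : boundary_act a 1%g xi = xi.
Proof.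
have [x hx] := bseqs_nonempty xi.
have h1 := boundary_act_seqs 1%g hx.
apply: (bseqs_eq hyp h1 hx).
rewrite (_ : a 1%g \o x = x); first exact: bseqs_gromov hx.
by apply/funext => n /=; rewrite act1.
Qed.

Lemma limit_set_orbit xi (s : nat -> G) :
  boundary_seqs xi (fun n => a (s n) o) -> limit_set a o xi.
Proof.
move=> hs U; rewrite nbhsE => -[W [oW Wxi] WU].
have [t ht] := oW.2 xi Wxi.
have /asymptoticP/(_ (t + 2 * delta + 1))[n0 hn0] := bseqs_gromov hs.
exists (Inside (a (s n0) o)); split.
  by exists (a (s n0) o) => //; exists (s n0).
apply/WU/ht; rewrite /bord_ball /=.
apply: (@lt_le_trans _ _ (t + 1)%:E); first by rewrite lte_fin; lra.
apply: le_ereal_inf_tmp => _ [[x y] [/= -> hy] <-].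
have /asymptoticP/(_ (t + 2 * delta + 1))[n1 hn1] := bseqs_asymptotic hyp hs hy.
rewrite limf_einfE; apply: le_ereal_sup_tmp.
exists (ereal_inf [set (gp o (cst (a (s n0) o) ij.1) (y ij.2))%:E | ij in
    [set i | (n1 <= i)%N] `*` [set j | (n1 <= j)%N]]).
  exists ([set i | (n1 <= i)%N] `*` [set j | (n1 <= j)%N]) => //.
  exists ([set i | (n1 <= i)%N], [set j | (n1 <= j)%N]) => //.
  by split; exists n1.
apply: le_ereal_inf_tmp => _ [[i j] [/= hi hj] <-]; rewrite lee_fin.
have := gp_trans_ge hyp (hn0 n0 (maxn n0 n1) (leqnn _) (leq_maxl _ _))
  (hn1 (maxn n0 n1) j (leq_maxr _ _) hj).
have := delta_gt0; lra.
Qed.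

Lemma ray_gromov g : 0 < tl g -> gromov_seq o (ray g).
Proof.
move=> g0; have [K K0 ax] := lox_axis hyp delta_gt0 g0.
apply/asymptoticP => T; have [n0 hn0] := nat_gt ((T + K) / tl g).
rewrite ltr_pdivrMr// in hn0.
have key i j : (n0 <= i)%N -> (i <= j)%N -> T <= gp o (ray g i) (ray g j).
  move=> hi ij; have := gp_ray ax ij.
  have : n0%:R * tl g <= i%:R * tl g by rewrite ler_pM2r// ler_nat.
  rewrite /ray; lra.
exists n0 => i j hi hj; case: (leqP i j) => ij; first exact: key.
by rewrite gpC; apply: key => //; exact: ltnW.
Qed.

Lemma tl_orient b g : tl (orient b g) = tl g.
Proof. by case: b => //=; exact: tl_inv. Qed.

(** If xi is fixed by g, the Gromov products of xi with g^i o and with g^(-i) o add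
    up to about d(o, g^i o). So one of them is unbounded, and xi is one of the
    two ends of g. *)
Lemma lox_fixed g xi : 0 < tl g -> boundary_act a g xi = xi ->
  exists b, boundary_seqs xi (ray (orient b g)).
Proof.
have dg := delta_gt0; move=> g0 gxi.
apply: contrapT => /forallNP no_end.
have [x hx] := bseqs_nonempty xi.
have bounded b : exists C n0, forall i j, (n0 <= i)%N -> (n0 <= j)%N ->
    gp o (x i) (ray (orient b g) j) <= C.
  have gr : gromov_seq o (ray (orient b g)) by apply: ray_gromov; rewrite tl_orient.
  apply: (bounded_of_not_asymptotic hyp) => //; first exact: bseqs_gromov hx.
  by move=> h; apply: (no_end b); exact: bseqs_closed hx gr h.
have [C1 [n1 h1]] := bounded true; have [C2 [n2 h2]] := bounded false.
have fixX n : boundary_act a (g ^+ n)%g xi = xi.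
  elim: n => [|n IH]; first by rewrite expg0 boundary_act1.
  by rewrite expgS boundary_actM IH.
have fixXV n : boundary_act a (g ^- n)%g xi = xi.
  by rewrite -{1}(fixX n) -boundary_actM mulVg boundary_act1.
have [i0 hi0] := tl_unbounded (C1 + C2 + delta) g0.
pose i := (maxn i0 (maxn n1 n2)).
have li : C1 + C2 + delta < len (g ^+ i)%g by apply: hi0; rewrite leq_maxl.
have hi : boundary_seqs xi (a (g ^- i)%g \o x).
  by rewrite -(fixXV i); exact: boundary_act_seqs.
have /asymptoticP/(_ (C2 + 2 * delta))[n3 h3] := bseqs_asymptotic hyp hx hi.
pose n := (maxn n3 (maxn n1 n2)).
have n3n : (n3 <= n)%N by rewrite leq_maxl.
have [n1n n2n] : (n1 <= n)%N /\ (n2 <= n)%N by rewrite /n; lia.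
have [n1i n2i] : (n1 <= i)%N /\ (n2 <= i)%N by rewrite /i; lia.
have e1 := h1 n i n1n n1i; have e2 := h2 n i n2n n2i; have e3 := h3 n n n3n n3n.
rewrite /= /ray expVgn in e1 e2 e3.
have : gp o (a (g ^- i)%g (x n)) (a (g ^- i)%g o) <= C2 + delta.
  by apply: (gp_trans_le hyp e2); lra.
rewrite -(gp_act a (g ^+ i)%g) !actKV (gpC _ (x n)) => e4.
have := gp_swap o (a (g ^+ i)%g o) (x n); rewrite (metric_sym o) (gpC o) -/(len _).
lra.
Qed.

Lemma boundary_fixX g xi k : 0 < tl g -> (0 < k)%N ->
  boundary_act a (g ^+ k)%g xi = xi -> boundary_act a g xi = xi.
Proof.
move=> g0 k0 gk; have [|b hb] := lox_fixed _ gk.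
  by rewrite tl_exp mulr_gt0// ltr0n.
have cg : commute g (orient b (g ^+ k)%g).
  by case: b hb => _; [|apply: commuteV]; apply: commuteX.
have [h1 h2] : gromov_seq o (a g \o ray (orient b (g ^+ k)%g)) /\
    asymptotic o (ray (orient b (g ^+ k)%g)) (a g \o ray (orient b (g ^+ k)%g)).
  apply: (@asymptotic_near _ _ _ _ _ (len g)); first exact: bseqs_gromov hb.
  move=> n; rewrite /= /ray act_commute; last exact: commuteX.
  by rewrite act_isom metric_sym.
apply/esym; apply: (bseqs_eq hyp hb) h2.
exact: boundary_act_seqs.
Qed.

(** A point with a finite orbit would be fixed by a power of each loxodromic, hence
    by each loxodromic. *)
Lemma infinite_boundary_orbits : non_elementary a o ->
  forall (B : seq (boundary o)) xi, exists g, boundary_act a g xi \notin B.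
Proof.
move=> [p [q [p0 q0 disj]]] B xi.
apply: contrapT => /forallNP all_in.
have {}all_in g : boundary_act a g xi \in B.
  by apply/negPn/negP; exact: all_in.
have fixed g : 0 < tl g -> boundary_act a g xi = xi.
  move=> g0; pose s := [seq boundary_act a (g ^+ n)%g xi | n <- iota 0 (size B).+1].
  have /(uniqPn xi)[i [j [ij]]] : ~~ uniq s.
    apply/negP => us; have : (size s <= size B)%N.
      by apply: uniq_leq_size us _ => _ /mapP[n _ ->].
    by rewrite size_map size_iota ltnn.
  rewrite size_map size_iota => js.
  rewrite !(nth_map 0%N) ?size_iota ?nth_iota ?add0n//; try by rewrite (ltn_trans ij).
  move=> e; apply: (@boundary_fixX g xi (j - i)%N); rewrite ?subn_gt0//.
  rewrite -(mulKg (g ^+ i)%g (g ^+ (j - i))%g) -expgnDr subnKC ?(ltnW ij)//.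
  by rewrite boundary_actM -e -boundary_actM mulVg boundary_act1.
have : (boundary_fix a p `&` boundary_fix a q) xi by split; exact: fixed.
by rewrite disj.
Qed.

Lemma ray_conjg g t xi b : boundary_seqs xi (ray (orient b g)) ->
  boundary_seqs (boundary_act a t^-1%g xi) (ray (orient b (g ^ t)%g)).
Proof.
move=> h; have h1 := boundary_act_seqs t^-1%g h.
have oc : orient b (g ^ t)%g = ((orient b g) ^ t)%g.
  by case: b {h h1} => //=; rewrite conjVg.
have [h2 h3] : gromov_seq o (ray (orient b (g ^ t)%g)) /\
    asymptotic o (a t^-1%g \o ray (orient b g)) (ray (orient b (g ^ t)%g)).
  apply: (@asymptotic_near _ _ _ _ _ (len t)); first exact: bseqs_gromov h1.
  move=> n; rewrite /= /ray oc -conjXg conjgE actM act_isom actM act_isom.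
  by rewrite metric_sym.
exact: bseqs_closed h1 h2 h3.
Qed.

Definition independent_pair g h := exists2 K, 0 <= K & independent a o K g h.

Lemma independent_of_ends g h : 0 < tl g -> 0 < tl h ->
  (forall b b' xi, boundary_seqs xi (ray (orient b g)) ->
     ~ boundary_seqs xi (ray (orient b' h))) ->
  independent_pair g h.
Proof.
move=> g0 h0 disj.
have one b b' : exists2 K, 0 <= K &
    forall i j, gp o (ray (orient b g) i) (ray (orient b' h) j) <= K.
  have gg : gromov_seq o (ray (orient b g)) by apply: ray_gromov; rewrite tl_orient.
  have gh : gromov_seq o (ray (orient b' h)) by apply: ray_gromov; rewrite tl_orient.
  have [|C [n0 hC]] := bounded_of_not_asymptotic hyp delta_gt0 gg gh.
    have [xi hxi] := bseqs_of gg => gah; apply: (disj b b' xi hxi).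
    exact: bseqs_closed hxi gh gah.
  have lg := len_ge0 a o (orient b g); have lh := len_ge0 a o (orient b' h).
  have bnd u i : (i < n0)%N -> len (u ^+ i)%g <= n0%:R * len u.
    by move=> /ltnW hi; apply: le_trans (len_exp _ _ _ _) _; rewrite ler_wpM2r ?ler_nat ?len_ge0.
  have p1 : 0 <= n0%:R * len (orient b g) by rewrite mulr_ge0.
  have p2 : 0 <= n0%:R * len (orient b' h) by rewrite mulr_ge0.
  exists (`|C| + n0%:R * len (orient b g) + n0%:R * len (orient b' h)).
    by rewrite !addr_ge0.
  have C0 := normr_ge0 C; have CC := ler_norm C.
  move=> i j; case: (ltnP i n0) => hi.
    have := bnd (orient b g) i hi; have := gp_le o (ray (orient b g) i) (ray (orient b' h) j).
    rewrite /ray -/(len _); lra.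
  case: (ltnP j n0) => hj.
    have := bnd (orient b' h) j hj; have := gp_le o (ray (orient b' h) j) (ray (orient b g) i).
    rewrite gpC /ray -/(len _); lra.
  have := hC i j hi hj; lra.
have [K1 p1 h1] := one true true; have [K2 p2 h2] := one true false.
have [K3 p3 h3] := one false true; have [K4 p4 h4] := one false false.
exists (K1 + K2 + K3 + K4); first by lra.
move=> [] [] i j;
  [have := h1 i j|have := h2 i j|have := h3 i j|have := h4 i j]; rewrite /ray; lra.
Qed.

Lemma end_list (L : seq G) : exists B : seq (boundary o),
  forall h b xi, h \in L -> boundary_seqs xi (ray (orient b h)) -> xi \in B.
Proof.
have one h b : exists B : seq (boundary o), forall xi,
    boundary_seqs xi (ray (orient b h)) -> xi \in B.
  have [[xi hxi]|no] := pselect (exists xi : boundary o, boundary_seqs xi (ray (orient b h))).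
    exists [:: xi] => eta heta; rewrite inE; apply/eqP.
    exact: bseqs_eq heta hxi (bseqs_gromov heta).
  by exists [::] => xi hxi; exfalso; apply: no; exists xi.
elim: L => [|h L [B hB]]; first by exists [::].
have [B1 h1] := one h true; have [B2 h2] := one h false.
exists (B1 ++ B2 ++ B) => h' b xi; rewrite inE !mem_cat => /orP[/eqP ->|h'L] hxi.
  by case: b hxi => [/h1|/h2] ->; rewrite ?orbT.
by rewrite (hB _ _ _ h'L hxi) !orbT.
Qed.

(** The ends of a conjugate of g are the translates of the ends of g. *)
Lemma independent_of_avoid g t (L : seq G) (A B : seq (boundary o)) :
  0 < tl g -> (forall h, h \in L -> 0 < tl h) ->
  (forall h b xi, h \in [:: g] -> boundary_seqs xi (ray (orient b h)) -> xi \in A) ->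
  (forall h b xi, h \in L -> boundary_seqs xi (ray (orient b h)) -> xi \in B) ->
  (forall xi, xi \in A -> boundary_act a t xi \notin B) ->
  forall h, h \in L -> independent_pair (g ^ t^-1)%g h.
Proof.
move=> g0 L0 hA hB avoid h hL.
apply: independent_of_ends; rewrite ?translation_length_conj; [by []|exact: L0|].
move=> b b' xi hg hh.
have [|eta heta] := bseqs_of (@ray_gromov (orient b g) _).
  by rewrite tl_orient.
have := ray_conjg t^-1%g heta; rewrite invgK => hc.
have /negP := avoid eta (hA g b eta (mem_head _ _) heta); apply.
rewrite -(bseqs_eq hyp hg hc (bseqs_gromov hg)).
exact: hB hL hh.
Qed.

End BoundaryAction.

Section SimultaneousIndependence.
Context {R : realType} {G : groupType} {X Y : metricType R}.
Variables (aX : isometric_action G X) (oX : X) (deltaX : R).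
Variables (aY : isometric_action G Y) (oY : Y) (deltaY : R).
Hypothesis hypX : delta_hyperbolic (X := X) deltaX.
Hypothesis hypY : delta_hyperbolic (X := Y) deltaY.
Hypothesis deltaX_gt0 : 0 < deltaX.
Hypothesis deltaY_gt0 : 0 < deltaY.
Hypothesis neX : non_elementary aX oX.
Hypothesis neY : non_elementary aY oY.

(** [separate_finite_sets] applies to the disjoint union of the two boundaries, so
    that a single conjugation does for both actions. *)
Lemma independent_conjugate (g : G) (LX LY : seq G) :
  0 < translation_length aX oX g -> 0 < translation_length aY oY g ->
  (forall h, h \in LX -> 0 < translation_length aX oX h) ->
  (forall h, h \in LY -> 0 < translation_length aY oY h) ->
  exists t, (forall h, h \in LX -> independent_pair aX oX (g ^ t)%g h) /\
            (forall h, h \in LY -> independent_pair aY oY (g ^ t)%g h).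
Proof.
move=> gX gY hLX hLY.
pose f t (z : boundary oX + boundary oY) := match z with
  | inl xi => inl (boundary_act aX t xi) | inr xi => inr (boundary_act aY t xi) end.
have f1 z : f 1%g z = z.
  by case: z => xi /=; [rewrite (boundary_act1 _ hypX)|rewrite (boundary_act1 _ hypY)].
have fM t u z : f (t * u)%g z = f t (f u z).
  by case: z => xi /=; [rewrite (boundary_actM _ hypX)|rewrite (boundary_actM _ hypY)].
have finf (B : seq (boundary oX + boundary oY)) z : exists t, f t z \notin B.
  case: z => xi.
    have [t ht] := infinite_boundary_orbits hypX deltaX_gt0 neX
      (pmap (fun z => if z is inl xi then Some xi else None) B) xi.
    exists t; apply: contra ht => /= ht; rewrite mem_pmap; apply/mapP.
    by exists (inl (boundary_act aX t xi)).
  have [t ht] := infinite_boundary_orbits hypY deltaY_gt0 neY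
    (pmap (fun z => if z is inr xi then Some xi else None) B) xi.
  exists t; apply: contra ht => /= ht; rewrite mem_pmap; apply/mapP.
  by exists (inr (boundary_act aY t xi)).
have [AX hAX] := end_list aX oX hypX [:: g].
have [AY hAY] := end_list aY oY hypY [:: g].
have [BX hBX] := end_list aX oX hypX LX.
have [BY hBY] := end_list aY oY hypY LY.
have [t ht] := separate_finite_sets f1 fM finf
  (map inl AX ++ map inr AY) (map inl BX ++ map inr BY).
exists t^-1%g; split.
  apply: (independent_of_avoid hypX deltaX_gt0 gX hLX hAX hBX) => xi xiA.
  have : f t (inl xi) \notin map inl BX ++ map inr BY.
    by apply: ht; rewrite mem_cat map_f.
  by apply: contra => h; rewrite /f mem_cat map_f ?orbT.
apply: (independent_of_avoid hypY deltaY_gt0 gY hLY hAY hBY) => xi xiA.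
have : f t (inr xi) \notin map inl BX ++ map inr BY.
  by apply: ht; rewrite mem_cat map_f ?orbT.
by apply: contra => h; rewrite /f mem_cat map_f ?orbT.
Qed.

End SimultaneousIndependence.


(** * Continuity of the boundary map *)

Section BoundaryMap.
Context {R : realType} {G : groupType} {X Y : metricType R}.
Variables (aX : isometric_action G X) (oX : X) (deltaX : R).
Variables (aY : isometric_action G Y) (oY : Y) (deltaY : R).
Hypothesis hypX : delta_hyperbolic (X := X) deltaX.
Hypothesis hypY : delta_hyperbolic (X := Y) deltaY.
Hypothesis deltaX_gt0 : 0 < deltaX.
Hypothesis deltaY_gt0 : 0 < deltaY.
Variable f : boundary oX -> boundary oY.
Hypothesis f_cont : {within limit_set aX oX, continuous f}.
Hypothesis f_equiv : forall (g : G) (xi : boundary oX), limit_set aX oX xi ->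
  f (boundary_act aX g xi) = boundary_act aY g (f xi).
Local Notation lenX := (displacement aX oX).
Local Notation lenY := (displacement aY oY).
Local Notation tlX := (translation_length aX oX).
Local Notation tlY := (translation_length aY oY).

Lemma boundary_map_limit (xi : boundary oX) (zeta : boundary oY)
    (z : nat -> boundary oX) :
  limit_set aX oX xi -> (forall m, limit_set aX oX (z m)) ->
  (forall T, exists m0, forall m, (m0 <= m)%N -> close_points (z m) xi T) ->
  (forall T, exists m0, forall m, (m0 <= m)%N -> close_points (f (z m)) zeta T) ->
  f xi = zeta.
Proof.
move=> xiL zL z_xi fz_zeta; apply: contrapT => ne.
have [U Uxi [m0 hU]] := boundary_separation hypY deltaY_gt0 fz_zeta ne.
have /subspace_continuousP/(_ xi xiL U Uxi) := f_cont.
rewrite /fmap /= /within /= => /(nbhs_boundary hypX deltaX_gt0)[T hT].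
have [m1 hm1] := z_xi T.
apply: (hU (maxn m0 m1) (leq_maxl _ _)); apply: hT (zL _).
by apply: hm1; rewrite leq_maxr.
Qed.

Lemma ray_fixed (h : G) (xi : boundary oX) :
  boundary_seqs xi (ray aX oX h) -> boundary_act aX h xi = xi.
Proof.
move=> hxi.
have [h1 h2] : gromov_seq oX (aX h \o ray aX oX h) /\
    asymptotic oX (ray aX oX h) (aX h \o ray aX oX h).
  apply: (@asymptotic_near _ _ _ _ _ (lenX h)); first exact: bseqs_gromov hxi.
  move=> n; rewrite /= /ray act_commute; last exact: commuteX.
  by rewrite act_isom metric_sym.
by apply/esym; apply: (bseqs_eq hypX hxi _ h2); exact: boundary_act_seqs.
Qed.

(** The elements e supplied for each m almost fix o in X and carry g^m o near the ray
    of h, but act in Y near o like g^(-J) with J at least 2m. Let xi be the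
    attracting point of h in the boundary of X. Then e g^m xi converges to xi,
    while e g^m (f xi) converges to the repelling point of g, since f xi is an
    end of h and thus not an end of g. *)
Lemma no_slip (g h : G) (C : R) :
  0 < tlX g -> 0 < tlX h -> 0 < tlY g -> 0 < tlY h ->
  independent_pair aX oX g h -> independent_pair aY oY g h ->
  (forall m, exists e J l, [/\ (2 * m <= J)%N,
     [/\ mdist (aX e oX) oX <= C, m%:R * tlX g - C <= l%:R * tlX h &
         mdist (aX e (aX (g ^+ m)%g oX)) (aX (h ^+ l)%g oX) <= C],
     mdist (aY e oY) (aY (g^-1 ^+ J)%g oY) <= C &
     mdist (aY e (aY (g ^+ J)%g oY)) oY <= C]) -> False.
Proof.
move=> gX hX gY hY [KX KX0 indX] [KY KY0 indY] slips.
have dX := deltaX_gt0; have dY := deltaY_gt0.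
have [KhX KhX0 axh] := lox_axis hypX deltaX_gt0 hX.
have [KgY KgY0 axg] := lox_axis hypY deltaY_gt0 gY.
have [E hE] := choice slips.
have C0 : 0 <= C.
  by have [J [l [_ [h1 _ _] _ _]]] := hE 0; apply: le_trans (mdist_ge0 _ _) h1.
have [xi hxi] := bseqs_of (ray_gromov hypX deltaX_gt0 hX).
have xiL : limit_set aX oX xi by apply: (limit_set_orbit hypX deltaX_gt0 hxi).
pose z m := boundary_act aX (E m * g ^+ m)%g xi.
have zL m : limit_set aX oX (z m).
  apply: (@limit_set_orbit _ _ _ _ _ _ hypX deltaX_gt0 _ (fun n => E m * g ^+ m * h ^+ n)%g).
  rewrite (_ : (fun _ => _) = aX (E m * g ^+ m)%g \o ray aX oX h).
    exact: boundary_act_seqs.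
  by apply/funext => n; rewrite actM.
have [b hb] : exists b, boundary_seqs (f xi) (ray aY oY (orient b h)).
  by apply: (lox_fixed hypY deltaY_gt0 hY); rewrite -f_equiv// (ray_fixed hxi).
have gV : 0 < tlY g^-1%g by rewrite tl_inv.
have [zeta hzeta] := bseqs_of (ray_gromov hypY deltaY_gt0 gV).
(* Seen from o in X, the points e g^m h^i o, e g^m o, h^l o and h^j o lie in
   almost the same direction. *)
have z_xi m : close_points (z m) xi (m%:R * tlX g - (2 * C + KX + KhX) - 2 * deltaX).
  have [J [l [_ [e1 lb e2] _ _]]] := hE m.
  exists (aX (E m * g ^+ m)%g \o ray aX oX h), (ray aX oX h); split=> //.
    exact: boundary_act_seqs.
  exists l => i j hi hj; rewrite /ray /= actM.
  have A : m%:R * tlX g - KX - C <=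
      gp oX (aX (E m) (aX (g ^+ m)%g (aX (h ^+ i)%g oX))) (aX (E m) (aX (g ^+ m)%g oX)).
    rewrite -(gp_act aX (E m)^-1%g) !actK.
    have := gp_base oX (aX (E m)^-1%g oX) (aX (g ^+ m)%g (aX (h ^+ i)%g oX)) (aX (g ^+ m)%g oX).
    rewrite (metric_sym oX) -/(lenX _) lenV gpC -actM gp_prefix.
    have := indX false true m i; rewrite /= expVgn => p1.
    have := tl_le aX oX g m; rewrite /displacement in e1 *; lra.
  have B : m%:R * tlX g - C - C <= gp oX (aX (E m) (aX (g ^+ m)%g oX)) (aX (h ^+ l)%g oX).
    have := gp_point oX (aX (h ^+ l)%g oX) (aX (E m) (aX (g ^+ m)%g oX)) (aX (h ^+ l)%g oX).
    rewrite gp_xx (metric_sym (aX (h ^+ l)%g oX) (aX _ _)).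
    have := tl_le aX oX h l; rewrite /displacement; lra.
  have D : m%:R * tlX g - C - KhX <= gp oX (aX (h ^+ l)%g oX) (aX (h ^+ j)%g oX).
    by have := gp_ray axh hj; lra.
  have AB : m%:R * tlX g - (2 * C + KX + KhX) - deltaX <=
      gp oX (aX (E m) (aX (g ^+ m)%g (aX (h ^+ i)%g oX))) (aX (h ^+ l)%g oX).
    by apply: (gp_trans_ge hypX (r := aX (E m) (aX (g ^+ m)%g oX))); lra.
  rewrite (_ : m%:R * tlX g - (2 * C + KX + KhX) - 2 * deltaX =
    m%:R * tlX g - (2 * C + KX + KhX) - deltaX - deltaX); last by lra.
  by apply: (gp_trans_ge hypX (r := aX (h ^+ l)%g oX)); lra.
(* In Y, eta has bounded Gromov products with the orbit of g, so that g^m eta and o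
   lie in almost the same direction seen from g^J o. The element e maps g^J o
   near o, and o near g^(-J) o. Thus e g^m eta and g^(-J) o lie in almost the
   same direction seen from o. *)
have fz_zeta m : close_points (f (z m)) zeta
    (m%:R * tlY g - (2 * C + 3 * KY + 3 * KgY) - 2 * deltaY).
  have [J [l [mJ _ e1 e2]]] := hE m.
  rewrite /z f_equiv//.
  exists (aY (E m * g ^+ m)%g \o ray aY oY (orient b h)), (ray aY oY g^-1%g).
  split=> //; first exact: boundary_act_seqs.
  exists J => i j hi hj; rewrite /ray /= actM.
  set eta := aY (orient b h ^+ i)%g oY.
  have mJ' : (m <= J)%N by apply: leq_trans mJ; rewrite leq_pmull.
  have EJ : (g ^+ J = g ^+ m * g ^+ (J - m))%g by rewrite -expgnDr subnKC.
  have mJR : 2 * (m%:R * tlY g) <= J%:R * tlY g.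
    by rewrite mulrA ler_pM2r// -natrM ler_nat.
  have J0 : 0 <= m%:R * tlY g by rewrite mulr_ge0// ltW.
  have A : m%:R * tlY g - 3 * KgY - KY - C <=
      gp oY (aY (E m) (aY (g ^+ m)%g eta)) (aY (E m) oY).
    rewrite -(gp_act aY (E m)^-1%g) !actK.
    have := gp_base (aY (g ^+ J)%g oY) (aY (E m)^-1%g oY) (aY (g ^+ m)%g eta) oY.
    have -> : mdist (aY (g ^+ J)%g oY) (aY (E m)^-1%g oY) = mdist (aY (E m) (aY (g ^+ J)%g oY)) oY.
      by rewrite -(act_isom aY (E m)) actKV.
    have -> : gp (aY (g ^+ J)%g oY) (aY (g ^+ m)%g eta) oY =
        gp (aY (g ^+ (J - m))%g oY) (aY (g ^- m)%g oY) eta.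
      rewrite EJ actM -[RHS](gp_act aY (g ^+ m)%g) actKV; exact: gpC.
    rewrite gp_swap.
    have -> : mdist (aY (g ^+ (J - m))%g oY) (aY (g ^- m)%g oY) = lenY (g ^+ J)%g.
      by rewrite len_dist invgK -EJ.
    have := gp_base (aY (g ^- m)%g oY) oY (aY (g ^+ (J - m))%g oY) eta.
    rewrite -/(lenY _) lenV.
    have := indY true b (J - m)%N i; rewrite /= -/eta.
    have := quasi_axis_len m axg; have := tl_le aY oY g J; lra.
  have B : m%:R * tlY g - C <= gp oY (aY (E m) oY) (aY (g^-1 ^+ J)%g oY).
    have := gp_point oY (aY (g^-1 ^+ J)%g oY) (aY (E m) oY) (aY (g^-1 ^+ J)%g oY).
    rewrite gp_xx (metric_sym _ (aY (E m) oY)) -/(lenY _) len_expV.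
    have := tl_le aY oY g J; lra.
  have D : m%:R * tlY g - KgY <= gp oY (aY (g^-1 ^+ J)%g oY) (aY (g^-1 ^+ j)%g oY).
    by have := gp_ray (quasi_axisV axg) hj; rewrite tl_inv; lra.
  have AB : m%:R * tlY g - (2 * C + 3 * KY + 3 * KgY) - deltaY <=
      gp oY (aY (E m) (aY (g ^+ m)%g eta)) (aY (g^-1 ^+ J)%g oY).
    by apply: (gp_trans_ge hypY (r := aY (E m) oY)); lra.
  rewrite (_ : m%:R * tlY g - (2 * C + 3 * KY + 3 * KgY) - 2 * deltaY =
    m%:R * tlY g - (2 * C + 3 * KY + 3 * KgY) - deltaY - deltaY); last by lra.
  by apply: (gp_trans_ge hypY (r := aY (g^-1 ^+ J)%g oY)); lra.
have grow (c K T : R) : 0 < c -> exists m0, forall m, (m0 <= m)%N -> T <= m%:R * c - K.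
  move=> c0; have [m0 h0] := nat_gt ((T + K) / c); exists m0 => m mm.
  rewrite ltr_pdivrMr// in h0.
  have : m0%:R * c <= m%:R * c by rewrite ler_pM2r// ler_nat.
  by lra.
have fxi : f xi = zeta.
  apply: (boundary_map_limit xiL zL) => T.
    have [m0 h0] := grow _ (2 * C + KX + KhX + 2 * deltaX) T gX; exists m0 => m mm.
    have [x [y [hx hy far]]] := z_xi m; exists x, y; split=> //.
    by apply: eventually_far_le far; have := h0 m mm; lra.
  have [m0 h0] := grow _ (2 * C + 3 * KY + 3 * KgY + 2 * deltaY) T gY; exists m0 => m mm.
  have [x [y [hx hy far]]] := fz_zeta m; exists x, y; split=> //.
  by apply: eventually_far_le far; have := h0 m mm; lra.
rewrite fxi in hb.
have /asymptoticP/(_ (KY + 1))[n0 h0] := bseqs_asymptotic hypY hzeta hb.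
have := h0 n0 n0 (leqnn _) (leqnn _); have := indY false b n0 n0; rewrite /ray /=; lra.
Qed.

End BoundaryMap.


(** * Nonprimitive products *)

(** Take half of the exponent: the ratio j / n then lies between 1/3 and 1/2. *)
Lemma root_of_nonprimitive (G : groupType) (w : G) : ~ primitive w ->
  exists v n j, [/\ (0 < n)%N, (0 < j)%N, (v ^+ n = w ^+ j)%g,
                    (2 * j <= n)%N & (n <= 3 * j)%N].
Proof.
move=> npw; suff [u [n [n1 uw]]] : exists u n, (1 < n)%N /\ w = (u ^+ n)%g.
  exists (u ^+ n./2)%g, n, n./2; split; try lia.
  by rewrite uw expgnAC.
apply: contrapT => no; apply: npw => u n n1; split=> uw; apply: no.
  by exists u, n.
by exists u^-1%g, n; rewrite expVgn.
Qed.

Section OneSpace.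
Context {R : realType} {G : groupType} {X : metricType R}.
Variables (a : isometric_action G X) (o : X) (delta : R).
Hypothesis hyp : delta_hyperbolic (X := X) delta.
Hypothesis delta_gt0 : 0 < delta.
Local Notation tl := (translation_length a o).
Implicit Types (g h : G).

Lemma independent_axes g h : 0 < tl g -> 0 < tl h -> independent_pair a o g h ->
  exists K, [/\ 0 <= K, quasi_axis a o K g, quasi_axis a o K h & independent a o K g h].
Proof.
move=> g0 h0 [K K0 ind]; have [Kg Kg0 axg] := lox_axis hyp delta_gt0 g0.
have [Kh Kh0 axh] := lox_axis hyp delta_gt0 h0.
exists (K + Kg + Kh); split; first by lra.
- by apply: quasi_axis_le axg; lra.
- by apply: quasi_axis_le axh; lra.
- by move=> b b' i j; apply: le_trans (ind _ _ _ _) _; lra.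
Qed.

Lemma large_multiple (B c : R) : 0 < c ->
  exists n0, forall n, (n0 <= n)%N -> B < n%:R * c.
Proof.
move=> c0; have [n0 h0] := nat_gt (B / c); exists n0 => n nn.
rewrite ltr_pdivrMr// in h0.
have : n0%:R * c <= n%:R * c by rewrite ler_pM2r// ler_nat.
by lra.
Qed.

Lemma product_estimates g h (rho : R) : 0 < tl g -> 0 < tl h ->
  independent_pair a o g h -> 0 < rho ->
  exists C N0, 0 <= C /\ forall N, (N0 <= N)%N ->
    let M := Num.truncn (rho * N%:R) in let w := (g ^+ N * h ^+ M)%g in
    `|tl w - N%:R * (tl g + rho * tl h)| <= C /\
    forall v n j i, (0 < n)%N -> (0 < j)%N -> (v ^+ n = w ^+ j)%g ->
      C < tl v -> (i <= N)%N ->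
      (forall k, (k <= N)%N ->
         mdist (a v (a (g ^+ i)%g o)) (a (g ^+ k)%g o)
           <= `|i%:R * tl g + tl v - k%:R * tl g| + C) /\
      (forall l, (l <= M)%N ->
         mdist (a v (a (g ^+ i)%g o)) (a (g ^+ N)%g (a (h ^+ l)%g o))
           <= `|i%:R * tl g + tl v - (N%:R * tl g + l%:R * tl h)| + C).
Proof.
move=> g0 h0 ind rho0; have [K [K0 axg axh indK]] := independent_axes g0 h0 ind.
have dg := delta_gt0.
have [n1 hn1] := large_multiple (2 * K + 3 * delta) g0.
have [n2 hn2] := large_multiple (2 * K + 3 * delta + tl h) (mulr_gt0 rho0 h0).
exists (100 * (K + delta) + tl h), (n1 + n2)%N; split; first by lra.
move=> N hN; have l1 := hn1 N (leq_trans (leq_addr _ _) hN).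
have l2 := hn2 N (leq_trans (leq_addl _ _) hN).
have rN : 0 <= rho * N%:R by rewrite mulr_ge0// ltW.
have /andP[] := truncn_itv rN; set M := Num.truncn _; rewrite -natr1 => m1 m2.
cbv zeta.
have h1 : M%:R * tl h <= rho * N%:R * tl h by rewrite ler_pM2r.
have h2 : rho * N%:R * tl h - tl h < M%:R * tl h.
  have : rho * N%:R * tl h < (M%:R + 1) * tl h by rewrite ltr_pM2r.
  by rewrite mulrDl mul1r ltrBlDr.
have lM : 2 * K + 3 * delta < M%:R * tl h by lra.
have b1 := product_tl_lower hyp delta_gt0 K0 indK l1 lM.
have b2 := product_tl_upper axg axh N M.
split; first by rewrite ler_norml; apply/andP; split; lra.
move=> v n j i n0 j0 vw lv iN.
have [|H1 H2] := product_root_shift hyp delta_gt0 K0 axg axh indK l1 lM n0 j0 vw _ iN.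
  by lra.
split=> [k kN|l ll].
  by apply: le_trans (H1 k kN) _; lra.
by apply: le_trans (H2 l ll) _; lra.
Qed.

End OneSpace.

Section Skew.
Context {R : realType} {G : groupType} {X Y : metricType R}.
Variables (aX : isometric_action G X) (oX : X) (deltaX : R).
Variables (aY : isometric_action G Y) (oY : Y) (deltaY : R).
Hypothesis hypX : delta_hyperbolic (X := X) deltaX.
Hypothesis hypY : delta_hyperbolic (X := Y) deltaY.
Hypothesis deltaX_gt0 : 0 < deltaX.
Hypothesis deltaY_gt0 : 0 < deltaY.
Local Notation tlX := (translation_length aX oX).
Local Notation tlY := (translation_length aY oY).

Definition ratio_to_one := forall e : R, 0 < e -> exists B, forall u : G,
  primitive u -> B < tlX u -> `|tlX u / tlY u - 1| < e.

Hypothesis ratio : ratio_to_one.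
Variables (g h : G).
Hypothesis gX : 0 < tlX g.
Hypothesis hX : 0 < tlX h.
Hypothesis gY : 0 < tlY g.
Hypothesis hY : 0 < tlY h.
Hypothesis indX : independent_pair aX oX g h.
Hypothesis indY : independent_pair aY oY g h.

(** The lengths of g^N h^M grow like N (l(g) + rho l(h)), and their ratio tends to 1
    along the primitive ones. *)
Lemma primitive_products (rho : R) : 0 < rho ->
  (forall N0, exists N, (N0 <= N)%N /\
     primitive (g ^+ N * h ^+ Num.truncn (rho * N%:R))%g) ->
  tlX g + rho * tlX h = tlY g + rho * tlY h.
Proof.
move=> rho0 prim; apply/eqP; rewrite -subr_eq0; apply/negPn/negP => ne.
have [C1 [N1 [C10 h1]]] := product_estimates hypX deltaX_gt0 gX hX indX rho0.
have [C2 [N2 [C20 h2]]] := product_estimates hypY deltaY_gt0 gY hY indY rho0.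
set A := tlX g + rho * tlX h in ne h1 *.
set A' := tlY g + rho * tlY h in ne h2 *.
have A0 : 0 < A by rewrite addr_gt0// mulr_gt0.
have A'0 : 0 < A' by rewrite addr_gt0// mulr_gt0.
have d0 : 0 < `|A - A'| by rewrite normr_gt0.
set d := `|A - A'| in d0.
pose e := d / (2 * A').
have e0 : 0 < e by rewrite divr_gt0// mulr_gt0.
have eA : e * A' = d / 2 by rewrite /e; field; rewrite gt_eqF.
have [B hB] := ratio e0.
have [N3 h3] := large_multiple (B + C1) A0.
have [N4 h4] := large_multiple C2 A'0.
have d20 : 0 < d / 2 by lra.
have [N5 h5] := large_multiple (C1 + C2 + e * C2) d20.
have [N [hN pN]] := prim (N1 + N2 + N3 + N4 + N5)%N.
have /h1[{}h1 _] : (N1 <= N)%N by clear -hN; lia.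
have /h2[{}h2 _] : (N2 <= N)%N by clear -hN; lia.
have /h3 {}h3 : (N3 <= N)%N by clear -hN; lia.
have /h4 {}h4 : (N4 <= N)%N by clear -hN; lia.
have /h5 {}h5 : (N5 <= N)%N by clear -hN; lia.
set w := (_ * _)%g in h1 h2 pN.
move: h1 h2; rewrite !ler_norml => /andP[u1 u2] /andP[v1 v2].
have wY : 0 < tlY w by lra.
have BwX : B < tlX w by lra.
have := hB w pN BwX.
have -> : tlX w / tlY w - 1 = (tlX w - tlY w) / tlY w by field; rewrite gt_eqF.
rewrite normrM normfV (gtr0_norm wY) ltr_pdivrMr// ltr_norml => /andP[r1 r2].
have wle : e * tlY w <= e * (N%:R * A' + C2) by rewrite ler_pM2l//; lra.
have wE : e * (N%:R * A' + C2) = N%:R * (d / 2) + e * C2 by rewrite -eA; ring.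
have [AA|AA] := lerP 0 (A - A').
  have dE : N%:R * d = N%:R * A - N%:R * A' by rewrite /d ger0_norm// mulrBr.
  lra.
have dE : N%:R * d = N%:R * A' - N%:R * A by rewrite /d ltr0_norm// opprB mulrBr.
lra.
Qed.

End Skew.


(** The arithmetic of [slips]. In X the blocks g^N and h^M have lengths N a and
    about rho N b, in Y they have lengths N a' and about rho N b'; D and D' are
    the shifts of v in X and in Y. The condition rho b <= a / 2 makes D at most
    N a, so that P exists. In Y the shift starting at g^P o falls short of the
    corner by N a' - P a' - D', which is at least
    th (W a' / a - W'), that is, th N rho (b a' / a - b') up to a constant. *)
Lemma slip_numbers (R : realType) (a b a' b' rho C C' W W' D D' th : R)
    (N M m : nat) :
  0 < a -> 0 < b -> 0 < a' -> 0 < b' -> 0 < rho -> rho * b <= a / 2 ->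
  0 <= C -> 0 <= C' ->
  4 * C < N%:R * (a + rho * b) -> 4 * C' < N%:R * (a' + rho * b') ->
  3 * (m%:R * a) + 2 * C < N%:R * a -> m%:R * a / b + 1 < N%:R * rho ->
  6 * (m%:R * a') + C * (a' / a) + C' < N%:R * (rho * (b * (a' / a) - b')) ->
  `|W - N%:R * (a + rho * b)| <= C -> `|W' - N%:R * (a' + rho * b')| <= C' ->
  rho * N%:R < M%:R + 1 -> 1 / 3 <= th -> th <= 1 / 2 ->
  D = th * W -> D' = th * W' ->
  [/\ C < D, C' < D' &
     exists P l J, [/\ (P + m <= N)%N, (P + J <= N)%N, (l <= M)%N & (2 * m <= J)%N] /\
       [/\ `|P%:R * a + D - N%:R * a| <= a, `|m%:R * a - l%:R * b| <= b &
           `|P%:R * a' + J%:R * a' + D' - N%:R * a'| <= a'] ].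
Proof.
move=> a0 b0 a'0 b'0 rho0 rho_small C0 C'0 c1 c2 c3 c4 c5.
rewrite !ler_norml => /andP[W1 W2] /andP[W'1 W'2] MN th1 th2 DE D'E.
have N0 : (0 : R) <= N%:R by rewrite ler0n.
have Nrho : N%:R * (rho * b) <= N%:R * (a / 2) by rewrite ler_wpM2l.
have Nrho0 : 0 <= N%:R * (rho * b) by rewrite mulr_ge0// ltW// mulr_gt0.
have ma0 : 0 <= m%:R * a by rewrite mulr_ge0// ltW.
have ma'0 : 0 <= m%:R * a' by rewrite mulr_ge0// ltW.
have W0 : 0 <= W by lra.
have W'0 : 0 <= W' by lra.
have D1 : 1 / 3 * W <= D by rewrite DE ler_wpM2r.
have D2 : D <= 1 / 2 * W by rewrite DE ler_wpM2r.
have D'1 : 1 / 3 * W' <= D' by rewrite D'E ler_wpM2r.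
have longD : C < D by lra.
have longD' : C' < D' by lra.
split=> //.
(* The integer parts P, l and J cost at most a, b and a' in length. *)
have gap : 0 <= N%:R * a - D by lra.
have /andP[] := truncn_itv (divr_ge0 gap (ltW a0)).
rewrite -natr1 ler_pdivlMr// ltr_pdivrMr//; move: (Num.truncn _) => P P1 P2.
have /andP[] := truncn_itv (divr_ge0 ma0 (ltW b0)).
rewrite -natr1 ler_pdivlMr// ltr_pdivrMr//; move: (Num.truncn _) => l l1 l2.
pose r := a' / a; rewrite -/r in c5.
have r0 : 0 < r by rewrite divr_gt0.
have ar : a' = a * r by rewrite /r mulrC divfK// gt_eqF.
clearbody r.
pose S := N%:R * a' - P%:R * a' - D'.
have S2 : 2 * (m%:R * a') <= S.
  have P1r : P%:R * a' <= (N%:R * a - D) * r by rewrite {1}ar mulrA ler_pM2r.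
  have Wr : (N%:R * (a + rho * b) - C) * r <= W * r by rewrite ler_pM2r//; lra.
  have Q : 6 * (m%:R * a') <= W * r - W' by rewrite ar in c5 W'2 *; lra.
  have : 1 / 3 * (W * r - W') <= th * (W * r - W') by rewrite ler_wpM2r//; lra.
  rewrite (_ : th * (W * r - W') = D * r - D'); last by rewrite DE D'E; ring.
  have NaE : (N%:R * a - D) * r = N%:R * a' - D * r by rewrite ar; ring.
  by rewrite /S; lra.
have S0 : 0 <= S by lra.
have mJ : (2 * m <= Num.truncn (S / a'))%N.
  rewrite truncn_ge_nat; last by rewrite divr_ge0// ltW.
  by rewrite ler_pdivlMr// natrM -mulrA.
have /andP[] := truncn_itv (divr_ge0 S0 (ltW a'0)).
rewrite -natr1 ler_pdivlMr// ltr_pdivrMr//.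
move: (Num.truncn _) mJ; rewrite /S => J mJ J1 J2.
exists P, l, J; split; split=> //.
- by rewrite -(ler_nat R) -(ler_pM2r a0) natrD; lra.
- by rewrite -(ler_nat R) -(ler_pM2r a'0) natrD; lra.
- rewrite -(ler_nat R); have : l%:R <= m%:R * a / b by rewrite ler_pdivlMr.
  by lra.
- by rewrite ler_norml; apply/andP; split; lra.
- by rewrite ler_norml; apply/andP; split; lra.
- by rewrite ler_norml; apply/andP; split; lra.
Qed.

Section Slip.
Context {R : realType} {G : groupType} {X Y : metricType R}.
Variables (aX : isometric_action G X) (oX : X) (deltaX : R).
Variables (aY : isometric_action G Y) (oY : Y) (deltaY : R).
Hypothesis hypX : delta_hyperbolic (X := X) deltaX.
Hypothesis hypY : delta_hyperbolic (X := Y) deltaY.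
Hypothesis deltaX_gt0 : 0 < deltaX.
Hypothesis deltaY_gt0 : 0 < deltaY.
Local Notation tlX := (translation_length aX oX).
Local Notation tlY := (translation_length aY oY).
Variables (g h : G).
Hypothesis gX : 0 < tlX g.
Hypothesis hX : 0 < tlX h.
Hypothesis gY : 0 < tlY g.
Hypothesis hY : 0 < tlY h.
Hypothesis indX : independent_pair aX oX g h.
Hypothesis indY : independent_pair aY oY g h.
Hypothesis skew : tlX g * tlY h < tlY g * tlX h.

(** With P as in [slip_numbers], e = g^(-N) v g^P. *)
Lemma slips (rho : R) (N0 : nat) : 0 < rho -> rho * tlX h <= tlX g / 2 ->
  (forall N, (N0 <= N)%N ->
     ~ primitive (g ^+ N * h ^+ Num.truncn (rho * N%:R))%g) ->
  exists C : R, forall m, exists e J l, [/\ (2 * m <= J)%N,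
     [/\ mdist (aX e oX) oX <= C, m%:R * tlX g - C <= l%:R * tlX h &
         mdist (aX e (aX (g ^+ m)%g oX)) (aX (h ^+ l)%g oX) <= C],
     mdist (aY e oY) (aY (g^-1 ^+ J)%g oY) <= C &
     mdist (aY e (aY (g ^+ J)%g oY)) oY <= C].
Proof.
move=> rho0 rho_small no_prim.
have [CX [NX [CX0 estX]]] := product_estimates hypX deltaX_gt0 gX hX indX rho0.
have [CY [NY [CY0 estY]]] := product_estimates hypY deltaY_gt0 gY hY indY rho0.
pose r := tlY g / tlX g.
have r0 : 0 < r by rewrite divr_gt0.
have ar : tlX g * r = tlY g by rewrite /r mulrC divfK// gt_eqF.
have kappa0 : 0 < rho * (tlX h * r - tlY h).
  by rewrite mulr_gt0// subr_gt0 /r mulrA ltr_pdivlMr// mulrC [ltRHS]mulrC.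
have A0 : 0 < tlX g + rho * tlX h by rewrite addr_gt0// mulr_gt0.
have A'0 : 0 < tlY g + rho * tlY h by rewrite addr_gt0// mulr_gt0.
exists (CX + CY + tlX g + tlX h + tlY g) => m.
have [n1 c1] := large_multiple (4 * CX) A0.
have [n2 c2] := large_multiple (4 * CY) A'0.
have [n3 c3] := large_multiple (3 * (m%:R * tlX g) + 2 * CX) gX.
have [n4 c4] := large_multiple (m%:R * tlX g / tlX h + 1) rho0.
have [n5 c5] := large_multiple (6 * (m%:R * tlY g) + CX * r + CY) kappa0.
pose N := (NX + NY + N0 + n1 + n2 + n3 + n4 + n5)%N.
have {}c1 : 4 * CX < N%:R * (tlX g + rho * tlX h) by apply: c1; rewrite /N; clear; lia.
have {}c2 : 4 * CY < N%:R * (tlY g + rho * tlY h) by apply: c2; rewrite /N; clear; lia.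
have {}c3 : 3 * (m%:R * tlX g) + 2 * CX < N%:R * tlX g by apply: c3; rewrite /N; clear; lia.
have {}c4 : m%:R * tlX g / tlX h + 1 < N%:R * rho by apply: c4; rewrite /N; clear; lia.
have {}c5 : 6 * (m%:R * tlY g) + CX * r + CY < N%:R * (rho * (tlX h * r - tlY h)).
  by apply: c5; rewrite /N; clear; lia.
have NXN : (NX <= N)%N by rewrite /N; clear; lia.
have NYN : (NY <= N)%N by rewrite /N; clear; lia.
have [v [n [j [n0 j0 vw jn nj]]]] : exists v n j, [/\ (0 < n)%N, (0 < j)%N,
    (v ^+ n = (g ^+ N * h ^+ Num.truncn (rho * N%:R)) ^+ j)%g,
    (2 * j <= n)%N & (n <= 3 * j)%N].
  by apply: root_of_nonprimitive; apply: no_prim; rewrite /N; clear; lia.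
move: (estX N NXN) (estY N NYN); cbv zeta => {estX estY no_prim}.
have rN : 0 <= rho * N%:R by rewrite mulr_ge0// ltW.
have /andP[_] := truncn_itv rN; rewrite -natr1.
move: vw; set w := (_ * _)%g; move: (Num.truncn _) @w => M w vw MN.
clearbody N.
have n0R : (0 : R) < n%:R by rewrite ltr0n.
pose th : R := j%:R / n%:R.
have th1 : th <= 1 / 2.
  have H : (2 * j)%:R <= n%:R :> R by rewrite ler_nat.
  by rewrite /th ler_pdivrMr//; rewrite natrM in H; lra.
have th2 : 1 / 3 <= th.
  have H : n%:R <= (3 * j)%:R :> R by rewrite ler_nat.
  by rewrite /th ler_pdivlMr//; rewrite natrM in H; lra.
have vX : tlX v = th * tlX w.
  have := congr1 tlX vw; rewrite !tl_exp => E; apply: (mulfI (lt0r_neq0 n0R)).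
  by rewrite E /th mulrA mulrCA divff ?mulr1// gt_eqF.
have vY : tlY v = th * tlY w.
  have := congr1 tlY vw; rewrite !tl_exp => E; apply: (mulfI (lt0r_neq0 n0R)).
  by rewrite E /th mulrA mulrCA divff ?mulr1// gt_eqF.
clearbody th.
move=> [wX /(_ v n j _ n0 j0 vw) rootX] [wY /(_ v n j _ n0 j0 vw) rootY].
have [longX longY [P [l [J [[PmN PJN lM mJ] [Pa ml PJa]]]]]] :=
  slip_numbers gX hX gY hY rho0 rho_small CX0 CY0 c1 c2 c3 c4 c5 wX wY MN
    th2 th1 vX vY.
have JN : (J <= N)%N by exact: leq_trans (leq_addl _ _) PJN.
have PN : (P <= N)%N by exact: leq_trans (leq_addr _ _) PmN.
pose e := (g ^- N * (v * g ^+ P))%g.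
have eX p q : mdist (aX e p) q = mdist (aX v (aX (g ^+ P)%g p)) (aX (g ^+ N)%g q).
  by rewrite -(act_isom aX (g ^+ N)%g) /e !actM actKV.
have eY p q : mdist (aY e p) q = mdist (aY v (aY (g ^+ P)%g p)) (aY (g ^+ N)%g q).
  by rewrite -(act_isom aY (g ^+ N)%g) /e !actM actKV.
have bnd (x y y' z c : R) : x <= `|y'| + c -> `|y| <= z -> y' = y -> x <= z + c.
  by move=> xy yz E; rewrite E in xy; apply: le_trans xy _; rewrite lerD2r.
have [[gX' hX'] gY'] := (ltW gX, ltW hX, ltW gY).
clear wX wY c1 c2 c3 c4 c5 rN MN rho_small th1 th2 kappa0 A0 A'0.
exists e, J, l; split=> //; first split.
- rewrite eX; apply: le_trans (bnd _ _ _ _ _ ((rootX P longX PN).1 N (leqnn N)) Pa erefl) _.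
  by lra.
- by move: ml; rewrite ler_norml => /andP[? ?]; lra.
- rewrite eX -(actM aX (g ^+ P)%g) -expgnDr.
  have Pml : `|P%:R * tlX g + tlX v - N%:R * tlX g + (m%:R * tlX g - l%:R * tlX h)|
      <= tlX g + tlX h by apply: le_trans (ler_normD _ _) _; exact: lerD.
  apply: le_trans (bnd _ _ _ _ _ ((rootX (P + m)%N longX PmN).2 l lM) Pml _) _.
    by rewrite natrD; ring.
  by lra.
- rewrite eY -(actM aY (g ^+ N)%g) expVgn -(_ : (g ^+ (N - J) = g ^+ N * g ^- J)%g); last first.
    by rewrite -{2}(subnK JN) expgnDr mulgK.
  apply: le_trans (bnd _ _ _ _ _ ((rootY P longY PN).1 (N - J)%N (leq_subr _ _)) PJa _) _.
    by rewrite natrB//; ring.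
  by lra.
- rewrite eY -(actM aY (g ^+ P)%g) -expgnDr.
  apply: le_trans (bnd _ _ _ _ _ ((rootY (P + J)%N longY PJN).1 N (leqnn N)) PJa _) _.
    by rewrite natrD; ring.
  by lra.
Qed.

Hypothesis ratio : ratio_to_one aX oX aY oY.
Variable f : boundary oX -> boundary oY.
Hypothesis f_cont : {within limit_set aX oX, continuous f}.
Hypothesis f_equiv : forall (u : G) (xi : boundary oX), limit_set aX oX xi ->
  f (boundary_act aX u xi) = boundary_act aY u (f xi).

(** The ratio condition can hold for one value of rho at most, unless the two
    lengths agree at g and at h. Two values are tried, both at most a / (2 b) as
    [slips] requires. *)
Lemma no_skew : False.
Proof.
have half c : 2 <= c -> exists rho : R, [/\ 0 < rho, rho * tlX h <= tlX g / 2 &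
    rho = tlX g / tlX h / c].
  move=> c2; have c0 : 0 < c by lra.
  exists (tlX g / tlX h / c); split=> //; first by rewrite !divr_gt0.
  rewrite mulrAC divfK ?gt_eqF// ler_pM2l// lef_pV2 ?posrE//.
have dich rho : 0 < rho -> rho * tlX h <= tlX g / 2 ->
    tlX g + rho * tlX h = tlY g + rho * tlY h.
  move=> rho0 small; apply: (primitive_products hypX hypY) => //.
  apply: contrapT => /existsNP[N0 no].
  have np N : (N0 <= N)%N -> ~ primitive (g ^+ N * h ^+ Num.truncn (rho * N%:R))%g.
    by move=> NN pN; apply: no; exists N.
  have [C hC] := slips rho0 small np.
  exact: (no_slip hypX hypY deltaX_gt0 deltaY_gt0 f_cont f_equiv gX hX gY hY indX indY hC).
have [rho1 [p1 s1 e1]] := half 2 (lexx _).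
have le23 : 2 <= 3 :> R by lra.
have [rho2 [p2 s2 e2]] := half 3 le23.
have E1 := dich _ p1 s1; have E2 := dich _ p2 s2.
have : (rho1 - rho2) * (tlX h - tlY h) = 0 by lra.
move/eqP; rewrite mulf_eq0 !subr_eq0 => /orP[/eqP e12|/eqP hh].
  have : tlX g / tlX h = 0 by lra.
  by move/eqP; rewrite gt_eqF// divr_gt0.
have gg : tlX g = tlY g by rewrite hh in E1; lra.
by move: skew; rewrite gg hh ltxx.
Qed.

End Slip.


(** * Transfer of loxodromicity *)

Lemma independent_pair_sym (R : realType) (G : groupType) (X : metricType R)
    (a : isometric_action G X) (o : X) (g h : G) :
  independent_pair a o g h -> independent_pair a o h g.
Proof. by move=> [K K0 ind]; exists K => // b b' i j; rewrite gpC. Qed.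

Section Degenerate.
Context {R : realType} {G : groupType} {X Y : metricType R}.
Variables (aX : isometric_action G X) (oX : X) (deltaX : R).
Variables (aY : isometric_action G Y) (oY : Y) (deltaY : R).
Hypothesis hypX : delta_hyperbolic (X := X) deltaX.
Hypothesis hypY : delta_hyperbolic (X := Y) deltaY.
Hypothesis deltaX_gt0 : 0 < deltaX.
Hypothesis deltaY_gt0 : 0 < deltaY.
Hypothesis neX : non_elementary aX oX.
Hypothesis neY : non_elementary aY oY.
Local Notation tlX := (translation_length aX oX).
Local Notation tlY := (translation_length aY oY).
Local Notation lenX := (displacement aX oX).
Local Notation lenY := (displacement aY oY).

(** Otherwise h^n has displacement o(n) in Y. One of g1^n h^n and g1^n k^n h^n, for
    independent conjugates g1 and k of g, is then loxodromic in Y and in X, so its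
    two lengths agree; but in X it is longer by about n tl h. *)
Lemma lox_transfer (g h : G) :
  (forall u, 0 < tlX u -> 0 < tlY u -> tlX u = tlY u) ->
  0 < tlX g -> 0 < tlY g -> 0 < tlX h -> 0 < tlY h.
Proof.
move=> agree gX gY hX; rewrite lt_neqAle tl_ge0 andbT; apply/negP => /eqP hY.
have dX := deltaX_gt0; have dY := deltaY_gt0.
have [t1 [indX1 _]] : exists t, (forall h', h' \in [:: h] -> independent_pair aX oX (g ^ t)%g h') /\
    (forall h', h' \in [::] -> independent_pair aY oY (g ^ t)%g h').
  apply: (independent_conjugate hypX hypY) => // h'.
  by rewrite inE => /eqP ->.
have {indX1}/indX1 := mem_head h [::]; set g1 := (g ^ t1)%g => indX1.
have gX1 : 0 < tlX g1 by rewrite translation_length_conj.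
have gY1 : 0 < tlY g1 by rewrite translation_length_conj.
have [t2 [indX2 indY2]] : exists t,
    (forall h', h' \in [:: g1; h] -> independent_pair aX oX (g ^ t)%g h') /\
    (forall h', h' \in [:: g1] -> independent_pair aY oY (g ^ t)%g h').
  apply: (independent_conjugate hypX hypY) => // h'; rewrite !inE.
    by case/orP => /eqP ->.
  by move=> /eqP ->.
have {}indY2 := indY2 g1 (mem_head _ _).
have indX3 : independent_pair aX oX (g ^ t2)%g h by apply: indX2; rewrite !inE eqxx orbT.
have {}indX2 := indX2 g1 (mem_head _ _).
move: indX2 indX3 indY2; set k := (g ^ t2)%g => indX2 indX3 indY2.
have kX : tlX k = tlX g by rewrite translation_length_conj.
have kY : tlY k = tlY g by rewrite translation_length_conj.
have g1X : tlX g1 = tlX g by rewrite translation_length_conj.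
have g1Y : tlY g1 = tlY g by rewrite translation_length_conj.
clearbody g1 k.
have ag : tlX g = tlY g by exact: agree.
have kY0 : 0 < tlY k by rewrite kY.
have [K1 K10 i1] := indX1; have [K2 K20 i2] := indX2; have [K3 K30 i3] := indX3.
have [K4 [K40 axk axg i4]] := independent_axes hypY deltaY_gt0 kY0 gY1 indY2.
pose K := K1 + K2 + K3.
have K0 : 0 <= K by rewrite /K; lra.
pose e := Num.min (tlX h / 2) (tlY g / 10).
have e0 : 0 < e by rewrite lt_min !divr_gt0.
have [e1 e2] : e <= tlX h / 2 /\ e <= tlY g / 10 by rewrite !ge_min !lexx orbT.
have [n0 c0] := tl_upper aY oY h e0.
have [n1 c1] := large_multiple (6 * K + 12 * deltaX) gX.
have [n2 c2] := large_multiple (6 * K + 12 * deltaX) hX.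
have gY2 : 0 < tlY g / 2 by lra.
have hX2 : 0 < tlX h / 2 by lra.
have [n3 c3] := large_multiple (5 * K4 + 12 * deltaY) gY2.
have [n4 c4] := large_multiple (6 * K + 12 * deltaX + 4 * K4) hX2.
pose n := (n0 + n1 + n2 + n3 + n4)%N.
have {}c0 : lenY (h ^+ n)%g <= n%:R * (tlY h + e) by apply: c0; rewrite /n; clear; lia.
have {}c1 : 6 * K + 12 * deltaX < n%:R * tlX g by apply: c1; rewrite /n; clear; lia.
have {}c2 : 6 * K + 12 * deltaX < n%:R * tlX h by apply: c2; rewrite /n; clear; lia.
have {}c3 : 5 * K4 + 12 * deltaY < n%:R * (tlY g / 2) by apply: c3; rewrite /n; clear; lia.
have {}c4 : 6 * K + 12 * deltaX + 4 * K4 < n%:R * (tlX h / 2).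
  by apply: c4; rewrite /n; clear; lia.
clearbody n.
have ne1 : n%:R * e <= n%:R * (tlX h / 2) by rewrite ler_wpM2l.
have ne2 : n%:R * e <= n%:R * (tlY g / 10) by rewrite ler_wpM2l.
have g1n := tl_le aX oX g1 n; have kn := tl_le aX oX k n; have hn := tl_le aX oX h n.
have g1nY := tl_le aY oY g1 n; have knY := tl_le aY oY k n.
have g1u := quasi_axis_len n axg; have ku := quasi_axis_len n axk.
rewrite -hY add0r in c0; rewrite g1X in g1n; rewrite kX in kn.
rewrite g1Y in g1nY g1u; rewrite kY in knY ku.
have tlX1 : n%:R * tlX g + n%:R * tlX h - 4 * (K + 2 * deltaX) <= tlX (g1 ^+ n * h ^+ n)%g.
  rewrite -{1}g1X; apply: (product_tl_lower hypX deltaX_gt0 K0).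
  - by move=> b b' i j; apply: le_trans (i1 _ _ _ _) _; rewrite /K; lra.
  - by rewrite g1X; lra.
  - by lra.
have tlX2 : n%:R * tlX g + n%:R * tlX g + n%:R * tlX h - 6 * K - 12 * deltaX <=
    tlX (g1 ^+ n * k ^+ n * h ^+ n)%g.
  have := @three_blocks_tl R G X aX oX deltaX hypX deltaX_gt0 (g1 ^+ n)%g (k ^+ n)%g (h ^+ n)%g K K0.
  move=> H; suff : lenX (g1 ^+ n)%g + lenX (k ^+ n)%g + lenX (h ^+ n)%g - 6 * K -
      12 * deltaX <= tlX (g1 ^+ n * k ^+ n * h ^+ n)%g by lra.
  apply: H; try lra.
  - have := i2 true false n n; rewrite /= expVgn gpC => H; apply: le_trans H _; rewrite /K; lra.
  - have := i3 false true n n; rewrite /= expVgn => H; apply: le_trans H _; rewrite /K; lra.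
  - have := i1 true false n n; rewrite /= expVgn gpC => H; apply: le_trans H _; rewrite /K; lra.
have agn : n%:R * tlX g = n%:R * tlY g by rewrite ag.
have [pos|pos] : 0 < tlY (g1 ^+ n * h ^+ n)%g \/ 0 < tlY (g1 ^+ n * k ^+ n * h ^+ n)%g.
  apply: (one_of_two_lox hypY deltaY_gt0 K40).
  - by have := i4 false false n n; rewrite /= !expVgn gpC.
  - by have := i4 true false n n; rewrite /= !expVgn gpC.
  - by lra.
  - by lra.
- have := agree (g1 ^+ n * h ^+ n)%g; have := tl_le_len aY oY (g1 ^+ n * h ^+ n)%g.
  have := lenM aY oY (g1 ^+ n)%g (h ^+ n)%g => l1 l2 /(_ _ pos) E.
  have {}E : tlX (g1 ^+ n * h ^+ n)%g = tlY (g1 ^+ n * h ^+ n)%g by apply: E; lra.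
  lra.
have := agree (g1 ^+ n * k ^+ n * h ^+ n)%g; have := tl_le_len aY oY (g1 ^+ n * k ^+ n * h ^+ n)%g.
have := lenM aY oY (g1 ^+ n * k ^+ n)%g (h ^+ n)%g; have := lenM aY oY (g1 ^+ n)%g (k ^+ n)%g.
move=> l1 l2 l3 /(_ _ pos) E.
have {}E : tlX (g1 ^+ n * k ^+ n * h ^+ n)%g = tlY (g1 ^+ n * k ^+ n * h ^+ n)%g by apply: E; lra.
lra.
Qed.

End Degenerate.

(** * Rigidity *)

Theorem theorem1 (R : realType) (G : groupType) (X Y : metricType R)
    (aX : isometric_action G X) (aY : isometric_action G Y) (oX : X) (oY : Y)
    (hypX : gromov_hyperbolic X) (hypY : gromov_hyperbolic Y)
    (neX : non_elementary aX oX) (neY : non_elementary aY oY)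
    (f : boundary oX -> boundary oY)
    (f_maps : set_fun (limit_set aX oX) (limit_set aY oY) f)
    (f_cont : {within limit_set aX oX, continuous f})
    (f_equiv : forall (g : G) (xi : boundary oX), limit_set aX oX xi ->
       f (boundary_act aX g xi) = boundary_act aY g (f xi))
    (long_classes : ProperFilter (long_primitive_classes aX oX))
    (ratio_cvg : class_length aX oX c / class_length aY oY c
                   @[c --> long_primitive_classes aX oX] --> (1 : R)) :
  forall g : G, translation_length aX oX g = translation_length aY oY g.
Proof.
have [dX dX0 hX] := hypX; have [dY dY0 hY] := hypY.
have ratio : ratio_to_one aX oX aY oY.
  move=> e e0; have /cvgrPdist_lt/(_ e e0)[B _ hB] := ratio_cvg.
  exists B => u pu Bu; have := hB (conj_class u).
  rewrite /= !class_lengthE distrC; apply; split=> //; by exists u.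
have sample e : 0 < e -> exists u, [/\ 0 < translation_length aX oX u,
    0 < translation_length aY oY u &
    `|translation_length aX oX u / translation_length aY oY u - 1| < e].
  move=> e0; pose e' := Num.min e (1 / 2).
  have e'0 : 0 < e' by rewrite lt_min e0; lra.
  have [B hB] := ratio e' e'0.
  have /(@filter_ex _ _ long_classes)[c [[u pu <-]]] :
      long_primitive_classes aX oX [set c | primitive_classes c /\
        Num.max B 0 < class_length aX oX c] by exists (Num.max B 0).
  rewrite class_lengthE gt_max => /andP[Bu u0]; exists u.
  have := hB u pu Bu; rewrite lt_min => /andP[r1 r2]; split=> //.
  rewrite lt_neqAle tl_ge0 andbT; apply/eqP => z; move: r2.
  by rewrite -z invr0 mulr0 sub0r normrN normr1; lra.
have proportional g h : 0 < translation_length aX oX g -> 0 < translation_length aY oY g ->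
    0 < translation_length aX oX h -> 0 < translation_length aY oY h ->
    translation_length aX oX g * translation_length aY oY h =
    translation_length aY oY g * translation_length aX oX h.
  move=> gX gY hX' hY'.
  have [t [indX indY]] : exists t,
      (forall h', h' \in [:: h] -> independent_pair aX oX (g ^ t)%g h') /\
      (forall h', h' \in [:: h] -> independent_pair aY oY (g ^ t)%g h').
    by apply: (independent_conjugate hX hY) => // h'; rewrite inE => /eqP ->.
  have {}indX := indX h (mem_head _ _); have {}indY := indY h (mem_head _ _).
  have gtX : translation_length aX oX (g ^ t)%g = translation_length aX oX g.
    exact: translation_length_conj.
  have gtY : translation_length aY oY (g ^ t)%g = translation_length aY oY g.
    exact: translation_length_conj.
  apply/eqP; rewrite eq_le !leNgt; apply/andP; split; apply/negP => lt.
    apply: (@no_skew R G X Y aX oX dX aY oY dY hX hY dX0 dY0 h (g ^ t)%g _ _ _ _ _ _ _ ratio f f_cont f_equiv);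
      rewrite ?gtX ?gtY//; try exact: independent_pair_sym.
    by rewrite mulrC [ltRHS]mulrC.
  by apply: (@no_skew R G X Y aX oX dX aY oY dY hX hY dX0 dY0 (g ^ t)%g h _ _ _ _ _ _ _ ratio f f_cont f_equiv);
      rewrite ?gtX ?gtY.
have agree g : 0 < translation_length aX oX g -> 0 < translation_length aY oY g ->
    translation_length aX oX g = translation_length aY oY g.
  move=> gX gY; apply/eqP; rewrite -subr_eq0 -normr_le0 leNgt; apply/negP => d0.
  have [u [uX uY]] := sample _ (divr_gt0 d0 gY).
  have -> : translation_length aX oX u / translation_length aY oY u =
      translation_length aX oX g / translation_length aY oY g.
    by apply/eqP; rewrite eqr_div ?lt0r_neq0// (proportional g u)// mulrC.
  have -> : translation_length aX oX g / translation_length aY oY g - 1 =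
      (translation_length aX oX g - translation_length aY oY g) / translation_length aY oY g.
    by field; rewrite gt_eqF.
  by rewrite normrM normfV (gtr0_norm gY) ltxx.
have [u [uX uY _]] := sample 1 ltr01.
have XY g : 0 < translation_length aX oX g -> 0 < translation_length aY oY g.
  exact: (lox_transfer hX hY dX0 dY0 neX neY agree uX uY).
have YX g : 0 < translation_length aY oY g -> 0 < translation_length aX oX g.
  apply: (lox_transfer hY hX dY0 dX0 neY neX _ uY uX) => g' ? ?.
  by rewrite agree.
move=> g; have := tl_ge0 aX oX g; rewrite le_eqVlt => /orP[/eqP gX|gX].
  have := tl_ge0 aY oY g; rewrite le_eqVlt => /orP[/eqP <-//|gY].
  by have := YX g gY; rewrite -gX ltxx.
exact: agree gX (XY g gX).
Qed.
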